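(* Let $(\theta,\eta)=((T_\infty,\ell),\eta)$ have law $\mu\otimes\mathcal B(1/2)$ and let $Q_\infty=\Phi(\theta,\eta)$. Almost surely, there exists an infinite sequence of distinct vertices $p_1,p_2,\dots\in V(Q_\infty)$ such that every proper geodesic ray emanating from $\varnothing$ passes through all of $p_1,p_2,\dots$.
   Context: **The law $\mu$.** $\rho_l$ is the law of a Galton–Watson plane tree with offspring law $P(k)=2^{-k-1}$, root label $l$, and each non-root vertex labeled by its parent's label plus an independent uniform element of $\{-1,0,1\}$. $\mu$ is the law of $(T_\infty,\ell)$, which has a spine $\varnothing=S(0),S(1),\dots$ whose labels $X_n=\ell(S(n))$ form a random walk from 0 with i.i.d. uniform steps in $\{-1,0,1\}$. Conditionally on $(X_n)$, independent trees $L_n$ (to the left of $S(n)$) and $R_n$ (to the right), with law $\rho_{X_n}$, are grafted at each spine vertex. **The Schaeffer map $\Phi$.** Corners of $T_\infty$ are indexed by $\mathbb Z$: $c_0,c_1,\dots$ are the left-side corners in clockwise contour order from the root corner $c_0$ of $\varnothing$, and $c_{-1},c_{-2},\dots$ are the right-side corners in counterclockwise order. The successor of $c_i$ is the first $c_j$ with $j>i$ and $\ell(c_j)=\ell(c_i)-1$. $\Phi(\theta,\eta)$ is the infinite quadrangulation with vertex set $V(T_\infty)$ whose edges are the arcs joining each corner to its successor. It is rooted at the arc from $c_0$ to its successor, with orientation reversed iff $\eta=1$. $\mathcal B(1/2)$ is the uniform law on $\{0,1\}$. **Proper geodesic rays.** A proper geodesic ray emanating from $\varnothing$ is an infinite path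 $(u_0,u_1,\dots)$ in $Q_\infty$ with $u_0=\varnothing$ and $\ell(u_i)=-i$ for all $i$. Such a path is automatically a geodesic ray. *)

(* Defs.v *)
From HB Require Import structures.
From mathcomp Require Import all_boot all_order all_algebra.
From mathcomp Require Import all_classical all_reals all_analysis.
From Stdlib Require List.
Set Implicit Arguments. Unset Strict Implicit. Unset Printing Implicit Defensive.
Import Order.TTheory GRing.Theory Num.Theory.
Local Open Scope classical_set_scope.
Local Open Scope ring_scope.

Inductive ltree := Node of int & seq ltree.

Definition root_label (t : ltree) : int := let: Node l _ := t in l.
Definition children (t : ltree) : seq ltree := let: Node _ ts := t in ts.
Definition leaf : ltree := Node 0 [::].

Fixpoint good_labels (t : ltree) : bool :=
  match t with
  | Node l ts =>
      (fix aux (ts : seq ltree) : bool :=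
         match ts with
         | [::] => true
         | c :: ts' => [&& (`|root_label c - l| <= 1)%R, good_labels c & aux ts']
         end) ts
  end.

(* GW weight with offspring law 2^{-k-1}, times 1/3 per non-root vertex
   (uniform label increment in {-1,0,1}). *)
Fixpoint gw_weight (R : realType) (t : ltree) : R :=
  match t with
  | Node _ ts =>
      (2^-1) ^+ (size ts).+1 *
      (fix aux (ts : seq ltree) : R :=
         match ts with
         | [::] => 1
         | c :: ts' => 3^-1 * gw_weight R c * aux ts'
         end) ts
  end.

Definition rho0 (R : realType) (t : ltree) : R :=
  if (root_label t == 0) && good_labels t then gw_weight R t else 0.

Fixpoint in_tree (t : ltree) (p : seq nat) : bool :=
  match p with
  | [::] => true
  | i :: p' => (i < size (children t))%N && in_tree (nth leaf (children t) i) p'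
  end.

Fixpoint lab_at (t : ltree) (p : seq nat) : int :=
  match p with
  | [::] => root_label t
  | i :: p' => lab_at (nth leaf (children t) i) p'
  end.

Fixpoint visits (t : ltree) (a : seq nat) : seq (seq nat) :=
  match t with
  | Node _ ts =>
      a :: (fix aux (ts : seq ltree) (i : nat) : seq (seq nat) :=
              match ts with
              | [::] => [::]
              | c :: ts' => visits c (rcons a i) ++ a :: aux ts' i.+1
              end) ts 0%N
  end.

(* Vertices of T_infty: spine vertex S(n), or a non-root vertex of
   L_n (side = true) or R_n (side = false), given by its address. *)
Inductive vert := Spine of nat | Sub of nat & bool & seq nat.

(* The data of theta = (T_infty, l):
   - xi n     : the (n+1)-th spine step, X_{n+1} - X_n ;
   - Lt n, Rt n : the trees L_n, R_n with labels shifted so that the root has label 0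
                  (so L_n = Lt n + X_n has law rho_{X_n}). *)
Section Tinf.
Variables (xi : nat -> int) (Lt Rt : nat -> ltree).

Definition Xs (n : nat) : int := \sum_(k < n) xi k.

Definition side_tree (n : nat) (b : bool) : ltree := if b then Lt n else Rt n.

Definition is_vertex (v : vert) : Prop :=
  match v with
  | Spine _ => True
  | Sub n b p => p <> [::] /\ in_tree (side_tree n b) p
  end.

Definition lab (v : vert) : int :=
  match v with
  | Spine n => Xs n
  | Sub n b p => Xs n + lab_at (side_tree n b) p
  end.

Definition to_vert (n : nat) (b : bool) (p : seq nat) : vert :=
  if p is [::] then Spine n else Sub n b p.

(* corners of S(n) and of L_n on the left side, in contour order *)
Definition blockL (n : nat) : seq vert := map (to_vert n true) (visits (Lt n) [::]).
(* corners of S(n) and of R_n on the right side, in counterclockwise order;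
   for n = 0 the root corner c_0 belongs to the left side *)
Definition blockR (n : nat) : seq vert :=
  map (to_vert n false)
      (if n is 0%N then behead (rev (visits (Rt n) [::])) else rev (visits (Rt n) [::])).

Fixpoint inf_nth (B : nat -> seq vert) (fuel m k : nat) : vert :=
  match fuel with
  | 0%N => Spine 0
  | fuel'.+1 => if (k < size (B m))%N then nth (Spine 0) (B m) k
                else inf_nth B fuel' m.+1 (k - size (B m))
  end.

(* Corner c_i (i : int) of T_infty, returned as the vertex it belongs to:
   c_0, c_1, ... left side (clockwise); c_{-1}, c_{-2}, ... right side
   (counterclockwise).  Only blockR 0 may be empty, so fuel k+2 suffices. *)
Definition corner (i : int) : vert :=
  match i with
  | Posz k => inf_nth blockL k.+2 0 k
  | Negz k => inf_nth blockR k.+2 0 k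
  end.

Definition labc (i : int) : int := lab (corner i).

Definition is_succ (i j : int) : Prop :=
  i < j /\ labc j = labc i - 1 /\
  forall k, i < k -> k < j -> labc k <> labc i - 1.

(* adjacency in Q_infty = Phi(theta, eta) (eta only orients the root edge) *)
Definition adjQ (u v : vert) : Prop :=
  exists i j, is_succ i j /\
    ((u = corner i /\ v = corner j) \/ (u = corner j /\ v = corner i)).

Definition proper_geodesic_ray (u : nat -> vert) : Prop :=
  u 0%N = Spine 0 /\
  (forall k, lab (u k) = - (k%:Z)) /\
  (forall k, adjQ (u k) (u k.+1)).

End Tinf.

Inductive atom :=
  | AXi of nat & int | AL of nat & ltree | AR of nat & ltree | AEta of bool.

Inductive idx := IXi of nat | IL of nat | IR of nat | IEta.

Definition atom_idx (a : atom) : idx :=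
  match a with AXi n _ => IXi n | AL n _ => IL n | AR n _ => IR n | AEta _ => IEta end.

Definition atom_ev (Omega : Type) (xi : nat -> Omega -> int) (Lt Rt : nat -> Omega -> ltree)
  (eta : Omega -> bool) (a : atom) : set Omega :=
  match a with
  | AXi n z => [set w | xi n w = z]
  | AL n t => [set w | Lt n w = t]
  | AR n t => [set w | Rt n w = t]
  | AEta b => [set w | eta w = b]
  end.

Definition mutually_independent d (Omega : measurableType d) (R : realType)
  (P : probability Omega R) (xi : nat -> Omega -> int) (Lt Rt : nat -> Omega -> ltree)
  (eta : Omega -> bool) : Prop :=
  forall s : seq atom, List.NoDup (map atom_idx s) ->
    P [set w | forall a, List.In a s -> atom_ev xi Lt Rt eta a w] =
    (\prod_(a <- s) fine (P (atom_ev xi Lt Rt eta a)))%:E.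

(* Main.v *)
Require Import Defs.
From HB Require Import structures.
From mathcomp Require Import all_boot all_order all_algebra.
From mathcomp Require Import all_classical all_reals all_analysis.
From mathcomp Require Import zify ring lra.
Set Implicit Arguments. Unset Strict Implicit. Unset Printing Implicit Defensive.
Import Order.TTheory GRing.Theory Num.Theory.
Import numFieldNormedType.Exports.
Local Open Scope classical_set_scope.
Local Open Scope ring_scope.

(* Explore the left side from a spine vertex S(a), pruning the subtree of every
   vertex whose label is a new minimum.  A proper geodesic ray moves along
   successors, so the labels between two consecutive corners stay at least the
   current label; hence, on the left side, a ray can only visit pruned vertices.
   Suppose that no subtree pruned before level T contains a label <= T.  Then the
   first left corner labelled T belongs to a vertex v none of whose ancestors is
   pruned, and a ray cannot jump over it from the left.  If moreover the right
   trees grafted before the block of v, and everything before S(a), have labels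
   > T, a ray cannot avoid v on the right either: v is a cut vertex.
   Given the exploration, the pruned subtrees are independent, so the condition
   on the left has probability prod_(1 <= l) l (l + 3) / ((l + 1) (l + 2)) = 1/3
   at least; the exchange of left and right trees gives the condition on the
   right with conditional probability bounded below.  This estimate holds
   whatever the past before S(a) is, so cut vertices occur at arbitrarily low
   levels almost surely. *)

(** The level [T = - K] must lie far enough down to clear the past, so the chance of success must
    not deteriorate as [K] grows. This is why only record subtrees are tested: there is one per
    level, and the bounds 2 / ((l + 1) (l + 2)) on their chances of descending by l are summable, so
    the product stays away from 0. The independence of these subtrees is never stated as such;
    instead [failure_bound] of the current record is shown to be a supermartingale of the
    exploration. Probabilities of windows are bounded by finite sums over [n] spine steps and trees
    of bounded height and degree. The order of choice is the past, then [K], then [n] (the spine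
    reaches [T] with probability at least 1/2), then [h] (little mass is lost by truncation). No
    stopping time is needed at the end: if b is the probability that no low cut vertex is ever
    produced and p m the probability that none is produced by time m, then b <= (1 - 1/64) p m for
    every m > 0, and p m tends to b. *)

Fixpoint ltree_code (t : ltree) : GenTree.tree nat :=
  let: Node l ts := t in GenTree.Node (pickle l) (map ltree_code ts).

Fixpoint ltree_decode (g : GenTree.tree nat) : ltree :=
  match g with
  | GenTree.Leaf _ => leaf
  | GenTree.Node n gs => Node (odflt 0 (unpickle n)) (map ltree_decode gs)
  end.

Lemma ltree_codeK : cancel ltree_code ltree_decode.
Proof.
rewrite /cancel; fix IH 1; case=> l ts /=; rewrite pickleK /=; congr Node.
by elim: ts => //= c ts ->; rewrite IH.
Qed.

HB.instance Definition _ := Countable.copy ltree (can_type ltree_codeK).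

Lemma ltree_indP (Q : ltree -> Prop) :
  (forall l ts, (forall c, c \in ts -> Q c) -> Q (Node l ts)) -> forall t, Q t.
Proof.
move=> H; fix IH 1; case=> l ts; apply: H.
elim: ts => [|c ts IHts] d; first by rewrite in_nil; discriminate.
rewrite inE => /predU1P[->|]; [exact: IH|exact: IHts].
Qed.

(** * Trees, their labels and their exploration *)

Section Exploration.
Variables (T y : int).

Fixpoint low (t : ltree) : bool :=
  let: Node l ts := t in (y + l <= T) || has low ts.

(* The exploration visits the corners of t (labels shifted by y) and keeps the
   least label m met so far; a vertex with a label < m is a new record, and the
   subtree below it is skipped ("pruned"). *)
Fixpoint record (m : int) (t : ltree) : int :=
  let: Node l ts := t in if y + l < m then y + l else foldl record m ts.

(* The same exploration, stopped when the record reaches T; it fails (None) as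
   soon as a pruned subtree contains a label <= T. *)
Fixpoint step (s : option int) (t : ltree) : option int :=
  let: Node l ts := t in
  if s is Some m then
    if m <= T then Some m
    else if y + l < m then
      if y + l <= T then Some (y + l)
      else if has low ts then None else Some (y + l)
    else foldl step (Some m) ts
  else None.

(* The label of the root of the pruned subtree that contains the vertex p. *)
Fixpoint mark (m : int) (t : ltree) (p : seq nat) : option int :=
  if y + root_label t < m then Some (y + root_label t)
  else if p is i :: p' then
    mark (foldl record m (take i (children t))) (nth leaf (children t) i) p'
  else None.

End Exploration.

Lemma visits_cat t a : visits t a = [seq a ++ p | p <- visits t [::]].
Proof.
elim/ltree_indP: t a => l ts IH a; rewrite /= cats0; congr (_ :: _).
elim: ts IH 0%N => //= c ts IHts IH i.
rewrite map_cat /= cats0 [visits c (rcons a i)]IH ?inE ?eqxx//.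
rewrite [visits c [:: i]]IH ?inE ?eqxx// -map_comp -IHts//; last first.
  by move=> d dts b; apply: IH; rewrite inE dts orbT.
by congr (_ ++ _); apply: eq_map => p /=; rewrite cat_rcons.
Qed.

Lemma visits_Node l ts : visits (Node l ts) [::] =
  [::] :: flatten [seq rcons [seq i :: p | p <- visits (nth leaf ts i) [::]] [::]
                  | i <- iota 0 (size ts)].
Proof.
rewrite /=; congr (_ :: _).
suff H (ts0 : seq ltree) : (fix aux (ts : seq ltree) (i : nat) : seq (seq nat) :=
  match ts with
  | [::] => [::]
  | c :: ts' => visits c (rcons [::] i) ++ [::] :: aux ts' i.+1
  end) ts (size ts0) = flatten [seq rcons [seq i :: p | p <- visits (nth leaf (ts0 ++ ts) i) [::]] [::]
                  | i <- iota (size ts0) (size ts)] by exact: (H [::]).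
elim: ts ts0 => //= c ts IHts ts0.
rewrite nth_cat ltnn subnn /= cat_rcons; congr (_ ++ _ :: _).
  by rewrite visits_cat.
by have := IHts (rcons ts0 c); rewrite size_rcons cat_rcons.
Qed.

Section Scan.
Variable y : int.

Definition tscan m t := [seq (y + lab_at t p, mark y m t p) | p <- visits t [::]].

(** [x] is the label of the common parent, which is not pruned; the contour returns to it after
    every sibling, whence the unmarked corner. *)
Fixpoint fscan x m ts :=
  if ts is c :: ts' then rcons (tscan m c) (x, None) ++ fscan x (record y m c) ts'
  else [::].

Lemma tscan_pruned m t : y + root_label t < m ->
  tscan m t = [seq (y + lab_at t p, Some (y + root_label t)) | p <- visits t [::]].
Proof. by move=> h; apply: eq_map => -[|i p] /=; rewrite h. Qed.

Lemma tscan_Node m l ts : ~~ (y + l < m) ->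
  tscan m (Node l ts) = (y + l, None) :: fscan (y + l) m ts.
Proof.
move=> h; rewrite /tscan visits_Node; set L := flatten _; rewrite map_cons /= (negbTE h).
congr (_ :: _); rewrite {}/L map_flatten -map_comp.
rewrite (eq_map (g := fun i => rcons (tscan (foldl (record y) m (take i ts)) (nth leaf ts i)) (y + l, None))); last first.
  move=> i /=; rewrite map_rcons /= (negbTE h); congr rcons.
  by rewrite -map_comp; apply: eq_map => p /=; rewrite (negbTE h).
suff H ts0 : flatten [seq rcons (tscan (foldl (record y) m (take i (ts0 ++ ts))) (nth leaf (ts0 ++ ts) i)) (y + l, None)
  | i <- iota (size ts0) (size ts)] = fscan (y + l) (foldl (record y) m ts0) ts by exact: (H [::]).
elim: ts ts0 => //= c ts IHts ts0.
rewrite nth_cat ltnn subnn /= take_size_cat//; congr (_ ++ _).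
by have := IHts (rcons ts0 c); rewrite size_rcons cat_rcons foldl_rcons.
Qed.

End Scan.

(* A pair (l, o) is a corner with label l; o is the label of the root of the
   pruned subtree containing it, if any. *)
Fixpoint scan (m : int) (s : seq (int * option int)) : option int :=
  if s is (l, o) :: s' then
    if o is Some m' then
      if (m' == m) || (m' < m) && (l == m') then scan m' s' else None
    else if m <= l then scan m s' else None
  else Some m.

Lemma scan_cat m s1 s2 :
  scan m (s1 ++ s2) = if scan m s1 is Some m' then scan m' s2 else None.
Proof.
by elim: s1 m => //= -[l [m'|]] s1 IH m; case: ifP.
Qed.

Lemma record_le y m t : record y m t <= m.
Proof.
elim/ltree_indP: t m => l ts IH m /=; case: ltP => [/ltW//|_].
elim: ts m IH => //= c cs IHcs m IH; apply: le_trans (IHcs _ _) (IH _ _ _); last by rewrite inE eqxx.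
by move=> d dcs; apply: IH; rewrite inE dcs orbT.
Qed.

(** [scan] checks three facts in one pass: marks never increase, each new mark is first met at a
    corner carrying that very label, and an unmarked corner is at least the current record. The
    check composes along concatenations, and the order properties used to trap a ray are read off
    from it. *)
Lemma scan_tscan y m t : scan m (tscan y m t) = Some (record y m t).
Proof.
elim/ltree_indP: t m => l ts IH m.
have [h|h] := boolP (y + l < m).
  rewrite tscan_pruned // [visits _ _]/= map_cons /= h eqxx orbT /=.
  by elim: (_ ts 0%N) => //= p s ->; rewrite eqxx.
rewrite tscan_Node//= (negbTE h) leNgt h /=.
have {h} : m <= y + l by rewrite leNgt.
elim: ts IH m => //= c ts IHts IH m h.
have hc : record y m c <= y + l by exact: le_trans (record_le _ _ _) h.
rewrite scan_cat -cats1 scan_cat IH ?inE ?eqxx//= hc.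
by apply: IHts => // d dts; apply: IH; rewrite inE dts orbT.
Qed.

Lemma low_visits T y t : low T y t = has (fun p => y + lab_at t p <= T) (visits t [::]).
Proof.
elim/ltree_indP: t => l ts IH; rewrite visits_Node /=; case: leP => //= h.
have -> ss : has (fun p => y + lab_at (Node l ts) p <= T) (flatten ss) =
    has (has (fun p => y + lab_at (Node l ts) p <= T)) ss.
  by elim: ss => //= s ss <-; rewrite has_cat.
rewrite has_map -[X in has _ X = _](take_size ts) -(map_nth_iota0 leaf)// has_map.
apply: eq_in_has => i /=; rewrite mem_iota /= add0n => hi.
by rewrite has_rcons /= leNgt h /= has_map IH ?mem_nth//; apply: eq_has => p /=.
Qed.

Lemma low_mono T T' y t : T <= T' -> low T y t -> low T' y t.
Proof. by move=> TT; rewrite !low_visits; apply: sub_has => p /= /le_trans; apply. Qed.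

Lemma low_bounded y t : exists B : int, forall T, T < B -> ~~ low T y t.
Proof.
suff [B h] : exists B : int, all (fun p => B <= y + lab_at t p) (visits t [::]).
  exists B => T TB; rewrite low_visits -all_predC; apply: sub_all h => p /=.
  by rewrite -ltNge; exact: lt_le_trans.
elim: visits => [|p s [B h]] /=; first by exists 0.
exists (Order.min (y + lab_at t p) B); rewrite ge_min lexx /=.
by apply: sub_all h => q /= h; rewrite ge_min h orbT.
Qed.

Lemma foldl_step_None T y ts : foldl (step T y) None ts = None.
Proof. by elim: ts => //= -[l cs] ts. Qed.

Lemma foldl_step_stop T y m ts : m <= T -> foldl (step T y) (Some m) ts = Some m.
Proof. by move=> h; elim: ts => //= -[l cs] ts; rewrite /= h. Qed.

Definition reaches (T m' : int) (s : seq (int * option int)) :=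
  exists pre post, s = pre ++ (m', Some m') :: post /\ all (fun e => T < e.1) pre.

Lemma reaches_catl T m' s1 s2 : reaches T m' s1 -> reaches T m' (s1 ++ s2).
Proof.
by move=> [p [q [-> h]]]; exists p, (q ++ s2); rewrite -catA cat_cons.
Qed.

Lemma reaches_catr T m' s1 s2 : all (fun e => T < e.1) s1 -> reaches T m' s2 ->
  reaches T m' (s1 ++ s2).
Proof.
by move=> h1 [p [q [-> h]]]; exists (s1 ++ p), q; rewrite catA all_cat h1 h.
Qed.

(** Unpruned corners are at least the current record, hence above [T] until the exploration stops,
    and the test on pruned subtrees keeps their corners above [T] as well. So the stopping corner is
    the first one at or below [T], and it is the root corner of a pruned subtree. *)
Lemma step_tscan T y m t m' : T < m -> step T y (Some m) t = Some m' ->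
  if m' <= T then reaches T m' (tscan y m t)
  else m' = record y m t /\ all (fun e => T < e.1) (tscan y m t).
Proof.
elim/ltree_indP: t m m' => l ts IH m m' hm.
rewrite [step _ _ _ _]/= leNgt hm [record _ _ _]/=; case: ltP => [lt_m|le_m].
  rewrite tscan_pruned//; case: ifP => [h [<-]|h].
    by rewrite h; exists [::], [seq (y + lab_at (Node l ts) p, Some (y + l)) | p <- behead (visits (Node l ts) [::])].
  case: ifP => // hl [<-]; rewrite h; split=> //.
  have : ~~ low T y (Node l ts) by rewrite /= h hl.
  rewrite low_visits -all_predC all_map => /sub_all; apply=> p /=.
  by rewrite -ltNge.
rewrite tscan_Node -?leNgt//.
have hx : T < y + l by exact: lt_le_trans hm le_m.
suff H : foldl (step T y) (Some m) ts = Some m' ->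
  if m' <= T then reaches T m' (fscan y (y + l) m ts)
  else m' = foldl (record y) m ts /\ all (fun e => T < e.1) (fscan y (y + l) m ts).
  move=> /H; case: ifP => _; last by rewrite /= hx.
  by move=> /(reaches_catr (s1 := [:: (y + l, None)])); apply; rewrite /= hx.
elim: ts m hm le_m IH => [|c ts IHts] m hm le_m IH.
  by move=> [<-]; rewrite leNgt hm.
rewrite [foldl _ _ _]/= [foldl _ _ _ in X in _ -> X]/= [fscan _ _ _ _]/=.
case E : (step T y (Some m) c) => [m1|]; last by rewrite foldl_step_None.
have := IH c (mem_head _ _) _ _ hm E; case: ifP => h1.
  rewrite foldl_step_stop// => h [<-]; rewrite h1; apply: reaches_catl.
  by rewrite -cats1; apply: reaches_catl.
move=> [m1E ac] hf; subst m1.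
have ac' : all (fun e => T < e.1) (rcons (tscan y m c) (y + l, None)).
  by rewrite all_rcons /= hx ac.
have := IHts _ _ (le_trans (record_le _ _ _) le_m) _ hf; rewrite ltNge h1 => /(_ isT).
case: ifP => [h2|h2] h.
  by apply: reaches_catr => //; apply: h => d dts; apply: IH; rewrite inE dts orbT.
have [d dts|-> ad] := h; first by apply: IH; rewrite inE dts orbT.
by rewrite all_cat ac'.
Qed.

(** * The exploration along consecutive spine vertices *)

Section Window.
Variable T : int.

Fixpoint run (x : int) (s : option int) (zs : seq int) (ts : seq ltree) : option int :=
  match zs, ts with
  | z :: zs', t :: ts' => run (x + z) (step T x s t) zs' ts'
  | _, _ => s
  end.

(** [low] also looks at the root, so the spine labels count. For lists of equal length the value is
    that length when no tree is low. *)
Fixpoint first_low (x : int) (zs : seq int) (ts : seq ltree) : nat :=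
  match zs, ts with
  | z :: zs', t :: ts' =>
      if low T x t then 0%N else (first_low (x + z) zs' ts').+1
  | _, _ => 0%N
  end.

Fixpoint wscan (x m : int) (zs : seq int) (ts : seq ltree) : seq (int * option int) :=
  match zs, ts with
  | z :: zs', t :: ts' => tscan x m t ++ wscan (x + z) (record x m t) zs' ts'
  | _, _ => [::]
  end.

Lemma scan_wscan x m zs ts : scan m (wscan x m zs ts).
Proof.
elim: zs ts x m => [|z zs IH] [|t ts] x m //=.
by rewrite scan_cat scan_tscan.
Qed.

Lemma run_None x zs ts : run x None zs ts = None.
Proof. by elim: zs ts x => [|z zs IH] [|[l cs] ts] x //=. Qed.

Lemma run_stop x m zs ts : m <= T -> run x (Some m) zs ts = Some m.
Proof.
move=> h; elim: zs ts x => [|z zs IH] [|[l cs] ts] x //=.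
by rewrite h IH.
Qed.

Lemma run_reaches x m zs ts m' : T < m -> m' <= T -> run x (Some m) zs ts = Some m' ->
  reaches T m' (wscan x m zs ts).
Proof.
move=> hm hm'; elim: zs ts x m hm => [|z zs IH] [|t ts] x m hm //=;
  try by move=> [E]; move: hm; rewrite E ltNge hm'.
case E : (step T x (Some m) t) => [m1|]; last by rewrite run_None.
have := step_tscan hm E; case: ifP => h1; first by rewrite run_stop// => h [<-]; apply: reaches_catl.
move=> [m1E ac] hf; apply: reaches_catr => //.
by rewrite -m1E; apply: IH => //; rewrite ltNge h1.
Qed.

End Window.

Notation corner0 := ((0, None) : int * option int).

Lemma scan_mark_le m s q mu : scan m s -> (q < size s)%N ->
  (nth corner0 s q).2 = Some mu -> mu <= m.
Proof.
elim: s m q => //= -[l [k|]] u IH n q /=.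
  case: ifP => // hk hu; case: q => [|q] /=; first by move=> _ [<-]; lia.
  by move=> hq /(IH _ _ hu hq); lia.
by case: ifP => // hk hu; case: q => [|q] //= hq /(IH _ _ hu hq).
Qed.

Lemma scan_mark_mono m s q q' mu mu' : scan m s -> (q <= q')%N -> (q' < size s)%N ->
  (nth corner0 s q).2 = Some mu -> (nth corner0 s q').2 = Some mu' -> mu' <= mu.
Proof.
elim: s m q q' => //= -[l o] u IH n [|q] [|q'] //= hs; first by move=> _ _ -> [->].
- move=> _ hq oE; move: hs; rewrite oE; case: ifP => // hk hu; exact: scan_mark_le hu hq.
- move=> h1 h2 h3 h4.
  by case: o hs => [k|]; case: ifP => // _ hu; exact: (IH _ q q' hu h1 h2 h3 h4).
Qed.

Lemma scan_mark_root m s q mu : scan m s -> (q < size s)%N ->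
  (nth corner0 s q).2 = Some mu ->
  mu = m \/ exists2 q0, (q0 <= q)%N & nth corner0 s q0 = (mu, Some mu).
Proof.
elim: s m q => //= -[l [k|]] u IH n q /=; case: ifP => // hk hu.
  case: q => [|q] /=.
    move=> _ [<-]; move: hk => /orP[/eqP->|/andP[_ /eqP->]]; first by left.
    by right; exists 0%N.
  move=> hq /(IH _ _ hu hq) [->|[q0 h0 E]]; last by right; exists q0.+1.
  move: hk => /orP[/eqP->|/andP[_ /eqP->]]; first by left.
  by right; exists 0%N.
case: q => [|q] //= hq /(IH _ _ hu hq) [->|[q0 h0 E]]; first by left.
by right; exists q0.+1.
Qed.

(** Unless it is above the initial record, an unmarked corner is above a record corner met earlier.
    An arc ending at it would have to pass over that record corner, which is how unpruned vertices
    are shown to be out of reach. *)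
Lemma scan_unmarked m s q : scan m s -> (q < size s)%N ->
  (nth corner0 s q).2 = None -> m <= (nth corner0 s q).1 \/
  exists q0 mu, [/\ (q0 < q)%N, nth corner0 s q0 = (mu, Some mu)
    & mu <= (nth corner0 s q).1].
Proof.
elim: s m q => //= -[l [k|]] u IH n q /=; case: ifP => // hk hu.
  case: q => [|q] //= hq /(IH _ _ hu hq) [h|[q0 [mu [h0 E h]]]].
    move: hk => /orP[/eqP<-|/andP[_ /eqP->]]; first by left.
    by right; exists 0%N, k.
  by right; exists q0.+1, mu.
case: q => [|q] /=; first by left.
move=> hq /(IH _ _ hu hq) [h|[q0 [mu [h0 E h]]]]; first by left.
by right; exists q0.+1, mu.
Qed.

(** * The contour of the infinite tree *)

Section Blocks.
Local Open Scope nat_scope.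
Variable sz : nat -> nat.
Hypothesis sz_gt0 : forall n, 0 < sz n.

Definition offset n := \sum_(i < n) sz i.

Lemma offsetS n : offset n.+1 = offset n + sz n.
Proof. by rewrite /offset big_ord_recr. Qed.

Lemma leq_offset n : n <= offset n.
Proof. by elim: n => // n IH; rewrite offsetS; have := sz_gt0 n; lia. Qed.

Lemma offset_mono m n : m <= n -> offset m <= offset n.
Proof.
move=> /subnKC <-; elim: (n - m) => [|k IH]; first by rewrite addn0.
by rewrite addnS offsetS; lia.
Qed.

Lemma offset_block m n p q : q < sz n -> offset m + p <= offset n + q -> m <= n.
Proof.
move=> hq h; rewrite leqNgt; apply/negP => /offset_mono; rewrite offsetS; lia.
Qed.

Lemma offset_split k : exists n p, p < sz n /\ k = offset n + p.
Proof.
elim: k => [|k [n [p [hp ->]]]]; first by exists 0, 0; rewrite sz_gt0 /offset big_ord0.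
have [h|h] := ltnP p.+1 (sz n); first by exists n, p.+1; rewrite addnS.
by exists n.+1, 0; rewrite sz_gt0 offsetS; split=> //; lia.
Qed.

End Blocks.

Lemma inf_nth_block (B : nat -> seq vert) n p fuel m : (p < size (B (m + n)))%N ->
  (n < fuel)%N ->
  inf_nth B fuel m (\sum_(i < n) size (B (m + i)) + p)%N = nth (Spine 0) (B (m + n)%N) p.
Proof.
elim: n m fuel => [|n IH] m [|fuel]//= hp hf; first by rewrite big_ord0 addn0 in hp *; rewrite hp.
rewrite big_ord_recl addn0 -addnA ltnNge leq_addr /= addKn -addSnnS.
have := IH m.+1 fuel; rewrite addSnnS => <- //; congr inf_nth; congr addn.
by apply: eq_bigr => i _; rewrite addSnnS.
Qed.

Definition adjacent_labels (x y : int) := (`|x - y| <= 1)%R.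

Definition contour t := [seq lab_at t p | p <- visits t [::]].

Lemma contour_Node l ts :
  contour (Node l ts) = l :: flatten [seq rcons (contour c) l | c <- ts].
Proof.
rewrite /contour visits_Node /= map_flatten -map_comp; congr (_ :: flatten _).
rewrite -[in RHS](take_size ts) -(map_nth_iota0 leaf)// -map_comp.
by apply: eq_map => i /=; rewrite map_rcons -map_comp.
Qed.

Lemma contour_cons t : exists s, contour t = root_label t :: s.
Proof. by case: t => l ts; rewrite contour_Node; eexists. Qed.

Lemma last_contour t x : last x (contour t) = root_label t.
Proof.
case: t => l ts; rewrite contour_Node /=.
by elim: ts l => //= c ts IH l; rewrite last_cat last_rcons IH.
Qed.

Lemma contour_sorted t : good_labels t -> sorted adjacent_labels (contour t).
Proof.
elim/ltree_indP: t => l ts IH; rewrite contour_Node /=.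
elim: ts IH => //= c ts IHts IH /and3P[hl hc hts].
rewrite cat_path last_rcons -cats1 cat_path last_contour /= IHts//; last first.
  by move=> d dts; apply: IH; rewrite inE dts orbT.
have := IH c (mem_head _ _) hc; case: (contour_cons c) => s -> /= ->.
by rewrite /adjacent_labels [`|l - _|]distrC hl.
Qed.

Section Corners.
Variables (xi : nat -> int) (Lt Rt : nat -> ltree).

Definition tree_size t := size (visits t [::]).

Lemma tree_size_gt0 t : (0 < tree_size t)%N.
Proof. by case: t => l ts; rewrite /tree_size visits_Node. Qed.

Definition offL := offset (fun n => tree_size (Lt n)).
Definition offR := offset (fun n => tree_size (Rt n)).

Lemma corner_left n p : (p < tree_size (Lt n))%N ->
  corner Lt Rt (Posz (offL n + p)) =
  to_vert n true (nth [::] (visits (Lt n) [::]) p).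
Proof.
move=> hp; rewrite /corner /offL /offset.
rewrite (eq_bigr (fun i : 'I_n => size (blockL Lt (0 + i)))); last first.
  by move=> i _; rewrite /blockL size_map.
rewrite inf_nth_block; [by rewrite /blockL (nth_map [::]) | by rewrite /blockL size_map |].
have B0 i : (0 < size (blockL Lt i))%N by rewrite size_map tree_size_gt0.
have : (n <= \sum_(i < n) size (blockL Lt (0 + i)))%N := leq_offset B0 n.
by move=> h; apply: leq_ltn_trans h _; rewrite ltnS leqW// leq_addr.
Qed.

Definition rvisits n := rev (visits (Rt n) [::]).

Lemma size_rvisits n : size (rvisits n) = tree_size (Rt n).
Proof. by rewrite size_rev. Qed.

Lemma head_rvisits n : exists s, rvisits n = [::] :: s.
Proof.
rewrite /rvisits; case: (Rt n) => l ts; rewrite visits_Node.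
have [s ->] : exists s, ([::] :: flatten
     [seq rcons [seq i :: p | p <- visits (nth leaf ts i) [::]] [::]
        | i <- iota 0 (size ts)]) = rcons s [::].
  elim/last_ind: (iota 0 (size ts)) => [|s i [u E]]; first by exists [::].
  rewrite map_rcons flatten_rcons -rcons_cat /=.
  by eexists (_ :: _).
by rewrite rev_rcons; eexists.
Qed.

(** [blockR 0] omits the root corner. Indexing by [- (offR n + p)] puts [c_0] in its place, since it
    has index 0 and belongs to the same vertex; all right blocks then have their full size. *)
Lemma corner_right n p : (p < tree_size (Rt n))%N ->
  corner Lt Rt (- (Posz (offR n + p))) =
  to_vert n false (nth [::] (rvisits n) p).
Proof.
have ge1 := tree_size_gt0 (Rt 0).
have [s0 E0] := head_rvisits 0.
have sB i : (size (blockR Rt i) + (i == 0) = tree_size (Rt i))%N.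
  rewrite size_map; case: i => [|i]; last by rewrite size_rev addn0.
  by rewrite -size_rvisits -/(rvisits 0) E0 /= addn1.
case: n => [|n] hp.
  rewrite /offR /offset big_ord0 add0n; case: p hp => [|p] hp /=.
    by rewrite E0 /= !/(blockL _ 0); case: (Lt 0) => l ts.
  rewrite -[LHS]/(corner Lt Rt (Negz p)) /corner.
  have h : (p < size (blockR Rt (0 + 0)))%N by have := sB 0%N; rewrite eqxx addn1; move: hp => /[swap] <-.
  have := inf_nth_block h (ltn0Sn p.+1); rewrite big_ord0 add0n => ->.
  rewrite add0n /blockR (nth_map [::]) -/(rvisits 0); last by move: h; rewrite /blockR size_map.
  by rewrite nth_behead.
have E : (offR n.+1 + p = (\sum_(i < n.+1) size (blockR Rt (0 + i)) + p).+1)%N.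
  rewrite /offR /offset big_ord_recl /= -(sB 0%N) [in RHS]big_ord_recl /=.
  rewrite addn1 !addSn; do 3 f_equal; apply: eq_bigr => i _.
  by rewrite -sB /= addn0.
rewrite E -[LHS]/(corner Lt Rt (Negz _)) /corner.
have h : (p < size (blockR Rt (0 + n.+1)))%N by have := sB n.+1; rewrite addn0 => ->.
rewrite inf_nth_block//.
  by rewrite add0n /blockR (nth_map [::]) //; rewrite size_rev.
have := leq_offset (fun i => tree_size_gt0 (Rt i)) n.+1.
move: E; rewrite /offR; lia.
Qed.

Hypothesis xi_le1 : forall n, `|xi n| <= 1.
Hypothesis goodL : forall n, root_label (Lt n) = 0 /\ good_labels (Lt n).
Hypothesis goodR : forall n, root_label (Rt n) = 0 /\ good_labels (Rt n).

Lemma lab_to_vert n b p :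
  lab xi Lt Rt (to_vert n b p) = Xs xi n + lab_at (side_tree Lt Rt n b) p.
Proof.
case: p => //=; case: b => /=; first by rewrite (goodL n).1 addr0.
by rewrite (goodR n).1 addr0.
Qed.

Lemma XsS n : Xs xi n.+1 = Xs xi n + xi n.
Proof. by rewrite /Xs big_ord_recr. Qed.

(** Each block starts and ends at its spine vertex, so passing from one block to the next is one
    step of the spine. *)
Lemma blocks_adjacent (f X : nat -> int) (B : nat -> seq int) :
  (forall n, (0 < size (B n))%N) ->
  (forall n, sorted adjacent_labels (B n)) ->
  (forall n, head 0 (B n) = X n) -> (forall n x, last x (B n) = X n) ->
  (forall n, adjacent_labels (X n) (X n.+1)) ->
  (forall n p, (p < size (B n))%N -> f (offset (fun n => size (B n)) n + p)%N = nth 0 (B n) p) ->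
  forall k, adjacent_labels (f k) (f k.+1).
Proof.
move=> B0 sB hB lB hX hf k; have [n [p [hp ->]]] := offset_split B0 k.
rewrite -addnS hf//; have [h|h] := ltnP p.+1 (size (B n)).
  rewrite hf//; have /(sortedP 0) := sB n; exact.
have pE : p = (size (B n)).-1 by lia.
have -> : (offset (fun n => size (B n)) n + p.+1 = offset (fun n => size (B n)) n.+1 + 0)%N.
  by rewrite offsetS addn0; have := B0 n; lia.
by rewrite hf// nth0 hB pE nth_last lB.
Qed.

Lemma left_adjacent k : adjacent_labels (labc xi Lt Rt (Posz k)) (labc xi Lt Rt (Posz k.+1)).
Proof.
pose B n := [seq Xs xi n + l | l <- contour (Lt n)].
have szB n : size (B n) = tree_size (Lt n) by rewrite !size_map.
apply: (@blocks_adjacent (fun k => labc xi Lt Rt (Posz k)) (Xs xi) B).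
- by move=> n; rewrite szB tree_size_gt0.
- move=> n; rewrite sorted_map; apply: sub_sorted (contour_sorted (goodL n).2).
  by move=> x y; rewrite /adjacent_labels /=; lia.
- by move=> n; rewrite /B; case: (contour_cons (Lt n)) => s -> /=; rewrite (goodL n).1 addr0.
- move=> n x; rewrite -nth_last szB (nth_map 0); last by rewrite size_map ltn_predL tree_size_gt0.
  by rewrite /tree_size -(size_map (lab_at (Lt n))) nth_last last_contour (goodL n).1 addr0.
- by move=> n; rewrite /adjacent_labels XsS; have := xi_le1 n; lia.
- move=> n p; rewrite szB => hp; rewrite /labc.
  have -> : offset (fun n => size (B n)) n = offL n by apply: eq_bigr => i _; rewrite szB.
  by rewrite corner_left// lab_to_vert /B -map_comp (nth_map [::]).
Qed.

Lemma right_adjacent k : adjacent_labels (labc xi Lt Rt (- Posz k)) (labc xi Lt Rt (- Posz k.+1)).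
Proof.
pose B n := rev [seq Xs xi n + l | l <- contour (Rt n)].
have szB n : size (B n) = tree_size (Rt n) by rewrite size_rev !size_map.
have headE n : head 0 [seq Xs xi n + l | l <- contour (Rt n)] = Xs xi n.
  by case: (contour_cons (Rt n)) => s -> /=; rewrite (goodR n).1 addr0.
have lastE n x : last x [seq Xs xi n + l | l <- contour (Rt n)] = Xs xi n.
  rewrite -nth_last size_map (nth_map 0); last by rewrite ltn_predL size_map tree_size_gt0.
  by rewrite nth_last last_contour (goodR n).1 addr0.
apply: (@blocks_adjacent (fun k => labc xi Lt Rt (- Posz k)) (Xs xi) B).
- by move=> n; rewrite szB tree_size_gt0.
- move=> n; rewrite rev_sorted sorted_map; apply: sub_sorted (contour_sorted (goodR n).2).
  by move=> x y; rewrite /adjacent_labels /=; lia.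
- move=> n; rewrite -nth0 nth_rev ?size_map ?tree_size_gt0// subn1 -(size_map (lab_at (Rt n))).
  by rewrite -(size_map (+%R (Xs xi n))) nth_last lastE.
- move=> n x; rewrite -nth_last nth_rev; last by rewrite size_rev prednK// -size_rev szB tree_size_gt0.
  by rewrite size_rev prednK ?subnn; [rewrite (set_nth_default 0) ?nth0 ?headE// | ];
     rewrite -size_rev szB tree_size_gt0.
- by move=> n; rewrite /adjacent_labels XsS; have := xi_le1 n; lia.
- move=> n p; rewrite szB => hp; rewrite /labc.
  have -> : offset (fun n => size (B n)) n = offR n by apply: eq_bigr => i _; rewrite szB.
  rewrite corner_right// lab_to_vert /B -map_comp -map_rev (nth_map [::])//.
  by rewrite size_rev.
Qed.

Lemma labc_succ_ge (i : int) : labc xi Lt Rt i - 1 <= labc xi Lt Rt (i + 1).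
Proof.
case: i => k.
  by have := left_adjacent k; rewrite /adjacent_labels -[Posz k + 1]/(Posz (k + 1)%N) addn1; lia.
have := right_adjacent k; rewrite NegzE /adjacent_labels.
have -> : - Posz k.+1 + 1 = - Posz k by lia.
lia.
Qed.

(** Labels fall by at most one from a corner to the next, on both sides and across [c_0]; they
    cannot go below the label of [i] before the first visit to the value just under it. *)
Lemma is_succ_ge (i j : int) : is_succ xi Lt Rt i j ->
  forall t, i <= t -> t < j -> labc xi Lt Rt i <= labc xi Lt Rt t.
Proof.
move=> [ij [_ hj]] t it tj.
have -> : t = i + Posz (absz (t - i)) by lia.
have : i + Posz (absz (t - i)) < j by lia.
elim: (absz _) => {t it tj} [|n IH] h; first by rewrite addr0.
have := hj (i + Posz n.+1); have := labc_succ_ge (i + Posz n).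
have -> : i + Posz n + 1 = i + Posz n.+1 by lia.
have := IH ltac:(lia); lia.
Qed.

End Corners.

(** * Every ray passes through the stopping vertex of a successful exploration *)

Lemma in_tree_visits t p : p \in visits t [::] -> in_tree t p.
Proof.
elim/ltree_indP: t p => l ts IH p; rewrite visits_Node inE => /predU1P[->//|].
move=> /flatten_mapP[i]; rewrite mem_iota add0n /= => hi.
rewrite mem_rcons inE => /predU1P[->//|/mapP[q qv ->]] /=.
by rewrite hi; apply: IH => //; apply: mem_nth.
Qed.

Lemma visits_0 t : nth [::] (visits t [::]) 0 = [::].
Proof. by case: t => l ts; rewrite visits_Node. Qed.

Fixpoint wrecord (x m : int) (zs : seq int) (ts : seq ltree) (i : nat) {struct i} : int :=
  match i, zs, ts with
  | i'.+1, z :: zs', t :: ts' => wrecord (x + z) (record x m t) zs' ts' i'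
  | _, _, _ => m
  end.

Lemma nth_wscan x m zs ts i p : size zs = size ts -> (i < size ts)%N ->
  (p < tree_size (nth leaf ts i))%N ->
  nth corner0 (wscan x m zs ts) (offset (fun j => tree_size (nth leaf ts j)) i + p) =
  nth corner0 (tscan (x + \sum_(j < i) zs`_j) (wrecord x m zs ts i) (nth leaf ts i)) p.
Proof.
elim: i zs ts x m => [|i IH] [|z zs] [|t ts]//= x m [hs] hi hp.
  by rewrite /offset !big_ord0 addr0 nth_cat size_map hp.
rewrite /offset !big_ord_recl -addnA nth_cat size_map -/(tree_size t) ltnNge leq_addr /=.
by rewrite addKn addrA -(IH zs ts).
Qed.

Lemma size_wscan x m zs ts : size zs = size ts ->
  size (wscan x m zs ts) = offset (fun j => tree_size (nth leaf ts j)) (size ts).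
Proof.
elim: zs ts x m => [|z zs IH] [|t ts]//= x m; first by rewrite /offset big_ord0.
by move=> [hs]; rewrite size_cat IH// /offset big_ord_recl size_map.
Qed.

Lemma leq_first_low T x zs ts b : size zs = size ts -> (b <= size ts)%N ->
  (forall i, (i < b)%N -> ~~ low T (x + \sum_(j < i) zs`_j) (nth leaf ts i)) ->
  (b <= first_low T x zs ts)%N.
Proof.
elim: b zs ts x => [|b IH] [|z zs] [|t ts]//= x [hs] hb h.
have := h 0%N isT; rewrite big_ord0 addr0 /= => /negbTE ->.
apply: IH => // i hi; have := h i.+1 hi.
by rewrite big_ord_recl /= addrA.
Qed.

Lemma first_low_not_low T x zs ts i : size zs = size ts ->
  (i < first_low T x zs ts)%N -> ~~ low T (x + \sum_(j < i) zs`_j) (nth leaf ts i).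
Proof.
elim: i zs ts x => [|i IH] [|z zs] [|t ts]//= x [hs]; case: ifP => // h.
  by rewrite big_ord0 addr0 h.
by move=> hi; rewrite big_ord_recl /= addrA; apply: IH.
Qed.

Lemma to_vert_inj n b p n' b' p' : to_vert n b p = to_vert n' b' p' ->
  [/\ n = n', p = p' & p = [::] \/ b = b'].
Proof.
case: p p' => [|i p] [|i' p'] //=; first by move=> [->]; split=> //; left.
by move=> [-> -> -> ->]; split=> //; right.
Qed.

Section CutVertex.
Variables (xi : nat -> int) (Lt Rt : nat -> ltree).
Hypothesis xi_le1 : forall n, `|xi n| <= 1.
Hypothesis goodL : forall n, root_label (Lt n) = 0 /\ good_labels (Lt n).
Hypothesis goodR : forall n, root_label (Rt n) = 0 /\ good_labels (Rt n).
Variables (a n K : nat).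
Let T : int := - (Posz K).
Let X := Xs xi a.
Let zs := mkseq (fun i => xi (a + i)%N) n.
Let ts := mkseq (fun i => Lt (a + i)%N) n.
Let ts' := mkseq (fun i => Rt (a + i)%N) n.

Hypothesis a_gt0 : (0 < a)%N.
Hypothesis past_high : forall i, (i < a)%N ->
  ~~ low (X - Posz K) (Xs xi i) (Lt i) && ~~ low (X - Posz K) (Xs xi i) (Rt i).
Variable m' : int.
Hypothesis m'_le : m' <= T.
Hypothesis run_m' : run T 0 (Some 1) zs ts = Some m'.
Hypothesis right_later : (first_low T 0 zs ts <= first_low T 0 zs ts')%N.

Let rl i := labc xi Lt Rt i - X.
Let W := wscan 0 1 zs ts.
Let mk i p := mark (Xs xi (a + i) - X) (wrecord 0 1 zs ts i) (Lt (a + i)) p.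

Let size_zs : size zs = size ts. Proof. by rewrite !size_mkseq. Qed.

Let XE i : (i <= n)%N -> 0 + \sum_(j < i) zs`_j = Xs xi (a + i) - X.
Proof.
move=> hi; rewrite add0r /X /Xs big_split_ord /= addrAC subrr add0r.
by apply: eq_bigr => j _; rewrite nth_mkseq//; apply: leq_trans hi.
Qed.

Let offE i : (i <= n)%N ->
  (offL Lt (a + i) = offL Lt a + offset (fun j => tree_size (nth leaf ts j)) i)%N.
Proof.
move=> hi; rewrite /offL /offset big_split_ord /=; congr addn.
by apply: eq_bigr => j _; rewrite nth_mkseq//; apply: leq_trans hi.
Qed.

Let size_W : (size W + offL Lt a = offL Lt (a + n))%N.
Proof. by rewrite offE// size_wscan// size_mkseq addnC. Qed.

Let W_at i p : (i < n)%N -> (p < tree_size (Lt (a + i)))%N ->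
  let q := (offset (fun j => tree_size (nth leaf ts j)) i + p)%N in
  [/\ (q < size W)%N, (offL Lt a + q = offL Lt (a + i) + p)%N &
  nth corner0 W q = (rl (Posz (offL Lt (a + i) + p)),
                     mk i (nth [::] (visits (Lt (a + i)) [::]) p))].
Proof.
move=> hi hp q; have qE : (offL Lt a + q = offL Lt (a + i) + p)%N.
  by rewrite offE 1?ltnW// -addnA.
split=> //.
  have : (offL Lt (a + i) + tree_size (Lt (a + i)) <= offL Lt (a + n))%N.
    rewrite /offL -(offsetS (fun n => tree_size (Lt n))).
    by apply: offset_mono; rewrite -addnS leq_add2l.
  move: size_W hp qE; lia.
rewrite nth_wscan ?size_mkseq//; last by rewrite nth_mkseq.
rewrite XE 1?ltnW// nth_mkseq// (nth_map [::])// /rl /labc corner_left// lab_to_vert//.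
by congr pair; rewrite addrAC.
Qed.

Let W_index q : (q < size W)%N -> exists i p, [/\ (i < n)%N,
  (p < tree_size (Lt (a + i)))%N, (q = offset (fun j => tree_size (nth leaf ts j)) i + p)%N &
  (offL Lt a + q = offL Lt (a + i) + p)%N].
Proof.
move=> hq; have [k [p [hp kE]]] := offset_split (fun i => tree_size_gt0 (Lt i)) (offL Lt a + q).
have ak : (a <= k)%N.
  apply: (@offset_block (fun i => tree_size (Lt i)) _ _ 0 _ hp).
  by rewrite addn0 -kE leq_addr.
have kn : (k < a + n)%N.
  rewrite ltnNge; apply/negP => /(@offset_mono (fun i => tree_size (Lt i))).
  move: kE size_W hq; rewrite /offL; lia.
exists (k - a)%N, p; have hi : (k - a < n)%N by lia.
have -> : (a + (k - a) = k)%N by lia.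
split=> //; move: (offE (ltnW hi)); have -> : (a + (k - a) = k)%N by lia.
move: kE; rewrite /offL; lia.
Qed.

Let scan_W : scan 1 W. Proof. exact: scan_wscan. Qed.

Variables (qe b pe : nat).
Hypothesis qe_W : (qe < size W)%N.
Hypothesis W_qe : nth corner0 W qe = (m', Some m').
Hypothesis W_lt_qe : forall q, (q < qe)%N -> T < (nth corner0 W q).1.
Hypothesis b_lt : (b < n)%N.
Hypothesis pe_lt : (pe < tree_size (Lt (a + b)))%N.
Hypothesis qe_E : (qe = offset (fun j => tree_size (nth leaf ts j)) b + pe)%N.
Let ve := to_vert (a + b) true (nth [::] (visits (Lt (a + b)) [::]) pe).

(* The vertices that a ray may visit before ve: in the explored region they are
   pruned, and the ray has not reached their level before the exploration did. *)
Inductive trapped (v : vert) : Prop :=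
| TrappedPast k s p of (k < a)%N & v = to_vert k s p
| TrappedLeft i p mu of (i < n)%N & v = to_vert (a + i) true p &
    mk i p = Some mu & lab xi Lt Rt v - X <= mu
| TrappedRight i p of (i < b)%N & v = to_vert (a + i) false p & p <> [::] &
    (forall j, (j <= i)%N -> lab xi Lt Rt v <= Xs xi (a + j)).

(** On the right a larger index means a position closer to the root, so among the spine vertices
    from [S(a)] on, an arc from block [a + j] can only meet [S(a + j')] with [j' <= j] while it
    stays on that side. The bound by their labels forbids it to end there, because a successor has a
    strictly smaller label. *)
Inductive trapped_corner (i : int) : Prop :=
| CornerPast k of i = Posz k & (k < offL Lt a)%N
| CornerLeft q mu of i = Posz (offL Lt a + q) & (q < qe)%N &
    (nth corner0 W q).2 = Some mu & rl i <= mu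
| CornerRight k l p of i = - Posz k & (0 < k)%N & (k = offR Rt l + p)%N &
    (p < tree_size (Rt l))%N &
    (l < a)%N \/ exists2 j, l = (a + j)%N & (j < b)%N /\
      (forall j', (j' <= j)%N -> labc xi Lt Rt i <= Xs xi (a + j')).

Let rl_W q : (q < size W)%N -> rl (Posz (offL Lt a + q)) = (nth corner0 W q).1.
Proof.
move=> /W_index [i [p [hi hp -> qE]]]; rewrite qE.
by have [_ _ ->] := W_at hi hp.
Qed.

(** The initial record 1 makes [S(a)], of relative label 0, the first record. *)
Let W_0 : nth corner0 W 0 = (0, Some 0).
Proof.
have n0 : (0 < n)%N by apply: leq_ltn_trans b_lt.
have h0 : (0 < tree_size (Lt (a + 0)))%N by exact: tree_size_gt0.
have [_ _] := W_at n0 h0; rewrite /offset big_ord0 addn0 => ->.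
rewrite /rl /labc corner_left// lab_to_vert// /mk visits_0 /=.
by rewrite (goodL _).1 addn0 -/X !addr0 subrr.
Qed.

Let root_mark q i mu : (i < n)%N -> q = offset (fun j => tree_size (nth leaf ts j)) i ->
  (nth corner0 W q).2 = Some mu -> mu = Xs xi (a + i) - X.
Proof.
move=> hi ->; have [_ _] := W_at hi (tree_size_gt0 _); rewrite addn0 => -> /=.
by rewrite /mk visits_0 /= (goodL _).1 addr0; case: ifP => // _ [<-].
Qed.

Let spine_label i : (i < n)%N ->
  (nth corner0 W (offset (fun j => tree_size (nth leaf ts j)) i)).1 = Xs xi (a + i) - X.
Proof.
move=> hi; have [hq qE] := W_at hi (tree_size_gt0 _); rewrite addn0 => ->.
rewrite /rl /labc corner_left ?tree_size_gt0// lab_to_vert//.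
by rewrite visits_0 /= (goodL _).1 addr0.
Qed.

(** If the spine corner is marked, its mark is its own label and later marks are no larger; if not,
    it dominates an earlier record. This gives the bound required of right corners when a ray uses a
    spine vertex to change sides. *)
Let spine_ge q mu j : (q < size W)%N -> (nth corner0 W q).2 = Some mu -> (j < n)%N ->
  (offset (fun j => tree_size (nth leaf ts j)) j <= q)%N -> mu <= Xs xi (a + j) - X.
Proof.
move=> hq hmu hj jq; set q0 := offset _ j in jq.
have hq0 : (q0 < size W)%N by exact: leq_ltn_trans hq.
case E : (nth corner0 W q0).2 => [nu|].
  by rewrite -(root_mark hj (erefl _) E); exact: (scan_mark_mono scan_W jq hq E hmu).
have [h|[q1 [nu [h1 E1 h2]]]] := scan_unmarked scan_W hq0 E.
  have : mu <= 0 by apply: (scan_mark_mono scan_W (leq0n _) hq _ hmu); rewrite W_0.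
  by move: h; rewrite spine_label//; lia.
move: h2; rewrite spine_label// => h2; apply: le_trans h2.
by apply: (scan_mark_mono scan_W _ hq _ hmu); [exact: leq_trans (ltnW h1) jq|rewrite E1].
Qed.

Let marked_lt_qe q mu : (q < size W)%N -> (nth corner0 W q).2 = Some mu -> T < mu ->
  (q < qe)%N.
Proof.
move=> hq hmu Tmu; rewrite ltnNge; apply/negP => h.
have : mu <= m' by apply: (scan_mark_mono scan_W h hq _ hmu); rewrite W_qe.
by move: Tmu m'_le; lia.
Qed.

Let off_mono i j : (i <= j)%N -> (offset (fun j => tree_size (nth leaf ts j)) i <=
  offset (fun j => tree_size (nth leaf ts j)) j)%N.
Proof. exact: offset_mono. Qed.

Lemma trapped_vertex_corner v i : corner Lt Rt i = v -> trapped v ->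
  T < lab xi Lt Rt v - X -> trapped_corner i.
Proof.
move=> <-{v} tv hT.
have [k kE] : exists k, i = Posz k \/ (i = - Posz k /\ (0 < k)%N).
  by case: i {tv hT} => k; [exists k; left|exists k.+1; right; rewrite NegzE].
case: kE => [iE|[iE k0]].
  have [l [p [hp kE]]] := offset_split (fun i => tree_size_gt0 (Lt i)) k.
  have cE : corner Lt Rt i = to_vert l true (nth [::] (visits (Lt l) [::]) p).
    by rewrite iE kE corner_left.
  case: tv; rewrite cE.
  - move=> k' s p' k'a /to_vert_inj[lE _ _]; apply: (CornerPast iE).
    rewrite kE /offL; have := @offset_mono (fun n => tree_size (Lt n)) k'.+1 a.
    by rewrite offsetS => /(_ k'a); move: hp; rewrite lE; lia.
  - move=> j p' mu hj /to_vert_inj[lE pE _] hmk; rewrite -cE => hmu; rewrite {}lE in kE hp cE pE.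
    have [hq qE WE] := W_at hj hp.
    have h2 : (nth corner0 W (offset (fun j => tree_size (nth leaf ts j)) j + p)).2 = Some mu.
      by rewrite WE /= pE.
    apply: (@CornerLeft _ (offset (fun j => tree_size (nth leaf ts j)) j + p)%N mu) => //.
      by rewrite qE iE kE.
    by apply: marked_lt_qe h2 _ => //; apply: lt_le_trans hmu.
  - move=> j p' _ /to_vert_inj[_ -> []] // ->//.
have [l [p [hp kE]]] := offset_split (fun i => tree_size_gt0 (Rt i)) k.
have cE : corner Lt Rt i = to_vert l false (nth [::] (rvisits Rt l) p).
  by rewrite iE kE corner_right.
apply: (CornerRight iE k0 kE hp).
case: tv; rewrite cE.
- by move=> k' s p' k'a /to_vert_inj[-> _ _]; left.
- move=> j p' mu hj /to_vert_inj[lE pE [p0|//]] hmk; rewrite -cE => hmu.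
  right; exists j => //.
  have [hq qE WE] := W_at hj (tree_size_gt0 (Lt (a + j))).
  have h2 : (nth corner0 W (offset (fun j => tree_size (nth leaf ts j)) j + 0)).2 = Some mu.
    rewrite WE /=; suff -> : nth [::] (visits (Lt (a + j)) [::]) 0 = p' by [].
    by rewrite visits_0 -pE p0.
  have Tmu : T < mu by apply: lt_le_trans hmu.
  have := marked_lt_qe hq h2 Tmu; rewrite qe_E => hlt.
  have jb : (j <= b)%N.
    apply: (@offset_block (fun j => tree_size (nth leaf ts j)) _ _ 0 pe); last by lia.
    by rewrite nth_mkseq.
  split.
    (* If [j = b], this spine vertex is itself a record, so its whole left tree carries the mark
       [mu > T]; but the corner [pe] of that tree carries [m' <= T]. *)
    rewrite ltn_neqAle jb andbT; apply/eqP => jbE.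
    have : mk b (nth [::] (visits (Lt (a + b)) [::]) pe) = Some m'.
      by have [_ _] := W_at b_lt pe_lt; rewrite -qe_E W_qe => -[_ <-].
    move: hmk; rewrite -pE p0 /mk -jbE /=; case: ifP => // h [E1].
    by case: (nth _ _ _) => [|? ?] /=; rewrite h => -[E]; move: m'_le Tmu; lia.
  move=> j' j'j; have j'n : (j' < n)%N by exact: leq_ltn_trans hj.
  have := spine_ge hq h2 j'n; rewrite addn0 => /(_ (off_mono j'j)).
  by move: hmu; rewrite /labc; lia.
- move=> j p' jb /to_vert_inj[lE pE _] p'0 h; right; exists j => //; split=> //.
  by move=> j' /h; rewrite /labc cE.
Qed.

Let offset_le_left k l p : (k < offL Lt a)%N -> k = (offset (fun i => tree_size (Lt i)) l + p)%N ->
  (l < a)%N.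
Proof.
move=> ka kE; rewrite ltnNge; apply/negP.
by move=> /(@offset_mono (fun i => tree_size (Lt i))); move: ka; rewrite kE /offL; lia.
Qed.

Let low_lt T' y t p : ~~ low T' y t -> p \in visits t [::] -> T' < y + lab_at t p.
Proof. by rewrite low_visits -all_predC => /allP h /h /=; rewrite -ltNge. Qed.

Let past_rl s k p : (k < a)%N -> p \in visits (side_tree Lt Rt k s) [::] ->
  T < lab xi Lt Rt (to_vert k s p) - X.
Proof.
move=> ka hp; rewrite lab_to_vert// /T -opprB; have /andP[h1 h2] := past_high ka.
by case: s hp => /= hp; have := low_lt _ hp; [move=> /(_ _ _ h1)|move=> /(_ _ _ h2)]; lia.
Qed.

(** All left corners of the blocks before [b] precede [qe], so the left trees there are not low and
    [b <= first_low T 0 zs ts]; [right_later] carries this over to the right trees. *)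
Let right_rl j p : (j < b)%N -> p \in visits (Rt (a + j)) [::] ->
  T < lab xi Lt Rt (to_vert (a + j) false p) - X.
Proof.
move=> jb hp; rewrite lab_to_vert//= addrAC.
have jn : (j < n)%N by exact: ltn_trans b_lt.
apply: low_lt => //; rewrite -XE 1?ltnW//.
have -> : Rt (a + j) = nth leaf ts' j by rewrite nth_mkseq.
apply: first_low_not_low; rewrite ?size_mkseq//; apply: leq_trans right_later.
apply: leq_trans jb _; apply: leq_first_low => //; first by rewrite size_mkseq ltnW.
move=> i ib; have hi : (i < n)%N by exact: ltn_trans b_lt.
rewrite XE 1?ltnW// nth_mkseq// low_visits -all_predC; apply/allP => q /(nthP [::])[r hr <-] /=.
rewrite -ltNge.
have [_ qE WE] := W_at hi hr.
have hlt : (offset (fun j => tree_size (nth leaf ts j)) i + r < qe)%N.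
  rewrite qe_E; have := off_mono ib; rewrite offsetS nth_mkseq//.
  by move: hr; rewrite -/(tree_size _); lia.
have := W_lt_qe hlt; rewrite WE /= /rl /labc corner_left// lab_to_vert//=.
by rewrite addrAC.
Qed.

(** No arc passes over the corner [qe]: relative to [X], the labels it covers are at least that of
    its origin, hence above [T], while [qe] is at level [m' <= T]. An arc that does not end at [qe]
    therefore ends in the past, on the right, or in the window before [qe]; in the last case its end
    is shown to be marked. *)
Lemma trapped_succ i j : is_succ xi Lt Rt i j -> trapped_corner i -> T < rl i ->
  corner Lt Rt j = ve \/ trapped (corner Lt Rt j) /\ T < rl j.
Proof.
move=> ij ti hT; have ge := is_succ_ge xi_le1 goodL goodR ij.
case: (ij) => lt_ij [lj _].
have rlj : rl j = rl i - 1 by rewrite /rl lj addrAC.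
have [k kE] : exists k, j = Posz k \/ (j = - Posz k /\ (0 < k)%N).
  by case: (j) => k; [exists k; left|exists k.+1; right; rewrite NegzE].
case: kE => [jE|[jE k0]]; last first.
  right; have [k1 [l1 [p1 [iE k1E hp1 hl1]]]] : exists k1 l1 p1, [/\ i = - Posz k1,
      k1 = (offR Rt l1 + p1)%N, (p1 < tree_size (Rt l1))%N &
      (l1 < a)%N \/ exists2 j, l1 = (a + j)%N & (j < b)%N /\
      (forall j', (j' <= j)%N -> labc xi Lt Rt i <= Xs xi (a + j'))].
    case: ti => [k1 iE|q mu iE|k1 l1 p1 iE _ k1E hp1 hl1]; try by move: lt_ij; rewrite iE jE; lia.
    by exists k1, l1, p1.
  have [l [p [hp kE]]] := offset_split (fun i => tree_size_gt0 (Rt i)) k.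
  have ll1 : (l <= l1)%N.
    apply: (@offset_block (fun i => tree_size (Rt i)) l l1 p p1 hp1).
    by move: lt_ij; rewrite iE jE -kE -/(offR Rt l1) -k1E; lia.
  have cE : corner Lt Rt j = to_vert l false (nth [::] (rvisits Rt l) p).
    by rewrite jE kE corner_right.
  have hv : nth [::] (rvisits Rt l) p \in visits (Rt l) [::].
    by rewrite -mem_rev; apply: mem_nth; rewrite size_rev.
  have [la|al] := ltnP l a.
    split; first exact: TrappedPast la cE.
    by rewrite /rl /labc cE; apply: past_rl.
  case: hl1 => [|[j1 l1E [j1b h]]]; first by lia.
  have lE : l = (a + (l - a))%N by lia.
  have lab1 : (l - a < b)%N by lia.
  move: (nth [::] (rvisits Rt l) p) cE hv => P cE; rewrite lE => hv.
  rewrite /rl /labc cE lE; split; last exact: right_rl.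
  rewrite -lE; apply: (TrappedRight (i := (l - a)%N) (p := P)) => //; first by rewrite -lE.
    move=> p0; have := h (l - a)%N ltac:(lia); rewrite -lE => h'.
    by move: lj; rewrite {1}/labc cE p0 -[lab _ _ _ _]/(Xs xi l); lia.
  move=> j' j'l; have := h j' ltac:(lia); move: lj; rewrite {1}/labc cE; lia.
have [ka|ak] := ltnP k (offL Lt a).
  right; have [l [p [hp kE]]] := offset_split (fun i => tree_size_gt0 (Lt i)) k.
  have cE : corner Lt Rt j = to_vert l true (nth [::] (visits (Lt l) [::]) p).
    by rewrite jE kE corner_left.
  have la := offset_le_left ka kE.
  split; first exact: TrappedPast la cE.
  by rewrite /rl /labc cE; apply: past_rl => //; apply: mem_nth.
have [q kE] : exists q, k = (offL Lt a + q)%N by exists (k - offL Lt a)%N; lia.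
have i_qe : i < Posz (offL Lt a + qe).
  by case: ti => [k1 ->|q1 mu ->|k1 l1 p1 ->]; lia.
have q_qe : (q <= qe)%N.
  rewrite leqNgt; apply/negP => hq.
  have := ge (Posz (offL Lt a + qe)) (ltW i_qe) ltac:(rewrite jE kE; lia).
  by have := rl_W qe_W; rewrite W_qe /rl /=; move: m'_le hT; rewrite /rl; lia.
have qW : (q < size W)%N by exact: leq_ltn_trans qe_W.
have := rl_W qW; rewrite -kE -jE => rjW.
move: q_qe; rewrite leq_eqVlt => /predU1P[qE|q_qe].
  left; rewrite jE kE qE qe_E.
  by have [_ -> _] := W_at b_lt pe_lt; rewrite corner_left.
right; split; last by rewrite rjW; exact: W_lt_qe.
(* A record lying between the corners [i] and [j] would contradict the choice of [j]. *)
have no_record q0 mu0 : (q0 < q)%N -> nth corner0 W q0 = (mu0, Some mu0) -> mu0 <= rl j -> False.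
  move=> q0q E0 mu0j; have q0W : (q0 < size W)%N by exact: ltn_trans qW.
  have iq0 : i <= Posz (offL Lt a + q0).
    case: ti => [k1 ->|q1 mu1 iE q1qe E1 h1|k1 l1 p1 ->]; try by lia.
    rewrite iE lez_nat leq_add2l ltnW// ltnNge; apply/negP => q01.
    have : mu1 <= mu0 by apply: (scan_mark_mono scan_W q01 _ _ E1); [exact: ltn_trans qe_W|rewrite E0].
    by move: mu0j; rewrite rlj; lia.
  have := ge _ iq0 ltac:(rewrite jE kE; lia).
  by have := rl_W q0W; rewrite E0 /rl /=; move: mu0j; rewrite rlj /rl; lia.
have [i0 [p0 [hi0 hp0 qE0 kE0]]] := W_index qW.
have cE : corner Lt Rt j = to_vert (a + i0) true (nth [::] (visits (Lt (a + i0)) [::]) p0).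
  by rewrite jE kE kE0 corner_left.
have [_ _] := W_at hi0 hp0; rewrite -qE0 => WE.
case E : (nth corner0 W q).2 => [mu|].
  apply: (@TrappedLeft _ _ _ mu hi0 cE); first by rewrite -E WE.
  rewrite -/(labc xi Lt Rt j) -/(rl j) leNgt; apply/negP => hmu.
  have [mu1|[q0 q0q E0]] := scan_mark_root scan_W qW E.
    have : mu <= 0 by apply: (scan_mark_mono scan_W (leq0n _) qW _ E); rewrite W_0.
    by rewrite mu1.
  apply: (no_record q0 mu) (ltW hmu) => //; rewrite ltn_neqAle q0q andbT; apply/eqP => q0E.
  by move: hmu; rewrite rjW -q0E E0 /= ltxx.
have [h|[q0 [mu0 [q0q E0 h]]]] := scan_unmarked scan_W qW E; last first.
  by case: (no_record q0 mu0 q0q E0); rewrite rjW.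
case: (no_record 0%N 0); rewrite ?W_0//; last by rewrite rjW; lia.
by rewrite lt0n; apply/eqP => q0; move: E; rewrite q0 W_0.
Qed.

Lemma ray_through_ve u : proper_geodesic_ray xi Lt Rt u -> exists k, u k = ve.
Proof.
move=> [u0 [ul ua]]; have X0 : T < - X.
  have := @past_rl true 0 [::] a_gt0; rewrite /= /Xs big_ord0 sub0r; apply.
  by case: (Lt 0) => l us; rewrite visits_Node inE.
suff H k : (exists k, u k = ve) \/ trapped (u k) /\ T < lab xi Lt Rt (u k) - X.
  (* At this time the ray is exactly at relative level [T], so it is no longer trapped. *)
  have [//|[_]] := H (absz (- X - T)); rewrite ul; lia.
elim: k => [|k [|[tk hT]]]; [|by left|].
  right; rewrite u0; split; first exact: (TrappedPast (s := true) (p := [::]) a_gt0).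
  by rewrite -u0 ul oppr0 sub0r.
(* The label drops along a ray, so the arc is followed from a corner to its successor; the reverse
   direction would raise it. *)
have [i [j [ij [[ui uj]|[ui uj]]]]] := ua k; last first.
  have := ul k; have := ul k.+1; case: ij => _ [+ _]; rewrite /labc -ui -uj; lia.
have ti := trapped_vertex_corner (esym ui) tk hT.
have := trapped_succ ij ti; rewrite /rl /labc -ui -uj => /(_ hT) [|]; last by right.
by left; exists k.+1.
Qed.

End CutVertex.

(** The bound on the label of [v] is kept because it will separate infinitely many cut vertices from
    one another. *)
Theorem cut_vertex (xi : nat -> int) (Lt Rt : nat -> ltree) (a n K : nat) (m : int) :
  (forall n, `|xi n| <= 1) ->
  (forall n, root_label (Lt n) = 0 /\ good_labels (Lt n)) ->
  (forall n, root_label (Rt n) = 0 /\ good_labels (Rt n)) ->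
  (0 < a)%N ->
  (forall i, (i < a)%N -> ~~ low (Xs xi a - Posz K) (Xs xi i) (Lt i) &&
     ~~ low (Xs xi a - Posz K) (Xs xi i) (Rt i)) ->
  let T := - Posz K in
  let zs := mkseq (fun i => xi (a + i)%N) n in
  let ts := mkseq (fun i => Lt (a + i)%N) n in
  let ts' := mkseq (fun i => Rt (a + i)%N) n in
  m <= T -> run T 0 (Some 1) zs ts = Some m ->
  (first_low T 0 zs ts <= first_low T 0 zs ts')%N ->
  exists v, [/\ is_vertex Lt Rt v, lab xi Lt Rt v <= Xs xi a - Posz K &
    forall u, proper_geodesic_ray xi Lt Rt u -> exists k, u k = v].
Proof.
move=> xi_le1 goodL goodR a_gt0 past T zs ts ts' mT run_m later.
have [|pre [post [WE pre_gt]]] := run_reaches _ mT run_m; first by rewrite /T; lia.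
set W := wscan _ _ _ _ in WE.
have qW : (size pre < size W)%N by rewrite WE size_cat /=; lia.
have Wq : nth corner0 W (size pre) = (m, Some m).
  by rewrite WE nth_cat ltnn subnn.
have Wlt q : (q < size pre)%N -> T < (nth corner0 W q).1.
  by move=> hq; rewrite WE nth_cat hq; move/all_nthP: pre_gt; apply.
have sz : size zs = size ts by rewrite !size_mkseq.
have t0 i : (0 < tree_size (nth leaf ts i))%N by exact: tree_size_gt0.
have [b [p [hp qE]]] := offset_split t0 (size pre).
have bn : (b < n)%N.
  rewrite ltnNge; apply/negP => /(@offset_mono (fun i => tree_size (nth leaf ts i))).
  by have := size_wscan 0 1 sz; rewrite size_mkseq -/W; move: qW qE; lia.
have tE : nth leaf ts b = Lt (a + b) by rewrite nth_mkseq.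
rewrite tE in hp.
have off_E : (offL Lt (a + b) = offL Lt a + offset (fun j => tree_size (nth leaf ts j)) b)%N.
  rewrite /offL /offset big_split_ord /=; congr addn.
  by apply: eq_bigr => j _; rewrite nth_mkseq//; apply: ltn_trans bn.
exists (to_vert (a + b) true (nth [::] (visits (Lt (a + b)) [::]) p)); split.
- have := in_tree_visits (mem_nth [::] hp).
  by case: (nth _ _ _) => [|i q] //= h; split.
- rewrite lab_to_vert//=; have := nth_wscan 0 1 sz (i := b) (p := p).
  rewrite size_mkseq tE -qE -/W Wq => /(_ bn hp); rewrite (nth_map [::])// => -[E _].
  have -> : Xs xi (a + b) = Xs xi a + \sum_(j < b) zs`_j.
    rewrite /Xs big_split_ord /=; congr (_ + _).
    by apply: eq_bigr => j _; rewrite nth_mkseq//; apply: ltn_trans bn.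
  move: mT; rewrite E /T add0r; move: (\sum_(j < b) _) (lab_at _ _) => S Q; lia.
- move=> u; exact: (ray_through_ve xi_le1 goodL goodR a_gt0 past mT later qW Wq Wlt bn hp qE).
Qed.

(** * The probability of a successful exploration *)

Definition steps : seq int := [:: -1; 0; 1].

Fixpoint forests (s : seq ltree) (b : nat) : seq (seq ltree) :=
  if b is b'.+1 then [::] :: [seq c :: f | c <- s, f <- forests s b'] else [:: [::]].

(** A finite part of the support of the tree law: [h] bounds the height and the numbers of children
    at once, and these lists exhaust the good trees as [h] grows. *)
Fixpoint trees (h : nat) (l : int) : seq ltree :=
  if h is h'.+1 then
    map (Node l) (forests (flatten [seq trees h' (l + d) | d <- steps]) h')
  else [::].

Definition branches h l := flatten [seq trees h (l + d) | d <- steps].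

Section Weights.
Variable R : realType.

(** The geometric law as fair coin tosses, one factor [2^-1] for each child and one to stop, so that
    a forest can be explored child by child. *)
Fixpoint forest_weight (ts : seq ltree) : R :=
  if ts is c :: ts' then 2^-1 * (3^-1 * gw_weight R c) * forest_weight ts' else 2^-1.

Lemma gw_weight_Node l ts : gw_weight R (Node l ts) = forest_weight ts.
Proof.
rewrite /=; elim: ts => [|c ts IH] /=; first by rewrite expr1 mulr1.
by rewrite -IH exprS; ring.
Qed.

Lemma gw_weight_ge0 t : 0 <= gw_weight R t.
Proof.
elim/ltree_indP: t => l ts IH; rewrite gw_weight_Node.
elim: ts IH => [|c ts IHts] IH /=; first by rewrite invr_ge0.
rewrite !mulr_ge0 ?invr_ge0//; first by apply: IH; rewrite mem_head.
by apply: IHts => d dts; apply: IH; rewrite inE dts orbT.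
Qed.

Lemma sum_trees h l (F : ltree -> R) :
  \sum_(t <- trees h.+1 l) gw_weight R t * F t =
  \sum_(f <- forests (branches h l) h) forest_weight f * F (Node l f).
Proof. by rewrite big_map; apply: eq_bigr => f _; rewrite gw_weight_Node. Qed.

Lemma sum_branches h l (F : ltree -> R) :
  \sum_(c <- branches h l) 3^-1 * gw_weight R c * F c =
  3^-1 * \sum_(d <- steps) \sum_(t <- trees h (l + d)) gw_weight R t * F t.
Proof.
rewrite big_flatten big_map mulr_sumr; apply: eq_bigr => d _.
by rewrite mulr_sumr; apply: eq_bigr => t _; rewrite mulrA.
Qed.

Lemma sum_forests s b (F : seq ltree -> R) :
  \sum_(f <- forests s b.+1) forest_weight f * F f =
  2^-1 * F [::] + 2^-1 * \sum_(c <- s) 3^-1 * gw_weight R c *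
    \sum_(f <- forests s b) forest_weight f * F (c :: f).
Proof.
rewrite /= big_cons big_allpairs_dep; congr (_ + _); rewrite mulr_sumr.
apply: eq_bigr => c _; rewrite mulrA mulr_sumr; apply: eq_bigr => f _ /=.
by rewrite -!mulrA.
Qed.

(* A geometric number of children is a process stopped with probability 1/2 at
   each stage: psi is the payoff at stopping, phi the value of the game. *)
Lemma forest_supermartingale (S : Type) (I : S -> Prop) (sigma : S -> ltree -> S)
  (psi phi : S -> R) (s : seq ltree) :
  (forall x, 0 <= phi x) ->
  (forall x c, I x -> I (sigma x c)) ->
  (forall x, I x -> 2^-1 * psi x + 2^-1 * \sum_(c <- s) 3^-1 * gw_weight R c * phi (sigma x c) <= phi x) ->
  forall b x, I x ->
    \sum_(f <- forests s b) forest_weight f * psi (foldl sigma x f) <= phi x.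
Proof.
move=> phi0 Isig hstep; elim=> [|b IH] x Ix.
  rewrite big_seq1 /=; apply: le_trans (hstep x Ix); rewrite lerDl mulr_ge0 ?invr_ge0//.
  by apply: sumr_ge0 => c _; rewrite !mulr_ge0 ?invr_ge0 ?gw_weight_ge0.
rewrite sum_forests; apply: le_trans (hstep x Ix).
rewrite lerD2l ler_wpM2l ?invr_ge0//; apply: ler_sum => c _.
rewrite ler_wpM2l ?mulr_ge0 ?invr_ge0 ?gw_weight_ge0//.
exact: IH (Isig _ _ Ix).
Qed.

Lemma average_le (F : int -> R) M : (forall d, d \in steps -> F d <= M) ->
  3^-1 * \sum_(d <- steps) F d <= M.
Proof.
move=> h; rewrite /steps !big_cons big_nil.
have := h (-1) isT; have := h 0 isT; have := h 1 isT; lra.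
Qed.

Lemma trees_mass_le1 h l : \sum_(t <- trees h l) gw_weight R t <= 1.
Proof.
elim: h l => [|h IH] l; first by rewrite big_nil.
under eq_bigr do rewrite -[gw_weight _ _]mulr1.
rewrite (sum_trees _ _ (fun=> 1)).
apply: (@forest_supermartingale unit (fun=> True) (fun x _ => x) (fun=> 1) (fun=> 1) _ _ _ _ h tt) => // _ _.
rewrite (sum_branches _ _ (fun=> 1)).
suff : 3^-1 * \sum_(d <- steps) \sum_(t <- trees h (l + d)) gw_weight R t * 1 <= 1 by lra.
by apply: average_le => d _; under eq_bigr do rewrite mulr1.
Qed.

(* The probability that a random tree reaches a level lying z below its root:
   the solution of u = a / (1 + a), a z = (u (z - 1) + u z + u (z + 1)) / 3. *)
Definition reach_bound (z : int) : R :=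
  if z <= 0 then 1 else 2 / ((z%:~R + 1) * (z%:~R + 2)).

Lemma reach_bound_ge0 z : 0 <= reach_bound z.
Proof.
rewrite /reach_bound; case: (leP z 0) => [_|z0]; first exact: ler01.
have h : (0 : R) < z%:~R by rewrite ltr0z.
by rewrite divr_ge0// mulr_ge0//; lra.
Qed.

Lemma reach_bound_le1 z : reach_bound z <= 1.
Proof.
rewrite /reach_bound; case: (leP z 0) => // z0.
have h : (1 : R) <= z%:~R by rewrite ler1z.
rewrite ler_pdivrMr; nra.
Qed.

Lemma reach_bound_step z : 0 < z ->
  let a := 3^-1 * \sum_(d <- steps) reach_bound (z + d) in
  2^-1 * (a + (1 - a) * reach_bound z) = reach_bound z.
Proof.
(* The rational expression also equals 1 at [k = 0], so the case [z = 1] needs no separate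
   treatment. *)
move=> z0; have E k : 0 <= k -> reach_bound k = 2 / ((k%:~R + 1) * (k%:~R + 2)).
  rewrite /reach_bound le_eqVlt => /predU1P[<-|k0]; last by rewrite leNgt k0.
  by rewrite lexx mulr0z !add0r mul1r divff ?pnatr_eq0.
rewrite /steps !big_cons big_nil /= !E; try lia.
have h : (1 : R) <= z%:~R by rewrite ler1z.
rewrite !intrD rmorphN1 mulr0z mulr1z; set x : R := z%:~R in h *.
field; repeat (apply/andP; split); apply: lt0r_neq0; lra.
Qed.

(** The game has one bit of state, whether a low child has been met: its value is 1 afterwards and
    [reach_bound z] before, with [reach_bound_step] as balance equation. *)
Lemma trees_low_le T y h l :
  \sum_(t <- trees h l) gw_weight R t * (low T y t)%:R <= reach_bound (y + l - T).
Proof.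
elim: h l => [|h IH] l; first by rewrite big_nil reach_bound_ge0.
have [xT|Tx] := leP (y + l) T.
  rewrite {1}/reach_bound subr_le0 xT; apply: le_trans (trees_mass_le1 h.+1 l).
  by apply: ler_sum => t _; rewrite ler_piMr ?gw_weight_ge0// lern1 leq_b1.
rewrite sum_trees; under eq_bigr do rewrite /= leNgt Tx /=.
have -> : \sum_(f <- forests (branches h l) h) forest_weight f * (has (low T y) f)%:R =
  \sum_(f <- forests (branches h l) h) forest_weight f *
    (foldl (fun b c => b || low T y c) false f)%:R.
  apply: eq_bigr => f _; congr (_ * (_ : bool)%:R).
  rewrite -[LHS]orFb; elim: f false => [|c f IHf] b /=; first by rewrite orbF.
  by rewrite orbA IHf.
set z := y + l - T.
have z0 : 0 < z by rewrite /z subr_gt0.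
pose phi (b : bool) : R := if b then 1 else reach_bound z.
apply: (@forest_supermartingale bool (fun=> True) _ (fun b => b%:R) phi _ _ _ _ h false) => //.
  by case; rewrite /phi ?ler01 ?reach_bound_ge0.
have mass : \sum_(c <- branches h l) 3^-1 * gw_weight R c * 1 <= 1.
  rewrite (sum_branches _ _ (fun=> 1)); apply: average_le => d _.
  by under eq_bigr do rewrite mulr1; exact: trees_mass_le1.
case=> _ /=; first by rewrite /phi; lra.
set a := 3^-1 * \sum_(d <- steps) reach_bound (z + d).
have low_a : \sum_(c <- branches h l) 3^-1 * gw_weight R c * (low T y c)%:R <= a.
  rewrite (sum_branches _ _ (fun c => (low T y c)%:R)) /a ler_pM2l ?invr_gt0//.
  apply: ler_sum => d _; apply: le_trans (IH _) _.
  by have -> : y + (l + d) - T = z + d by rewrite /z; ring.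
have := reach_bound_step z0; rewrite /= -/a.
have -> : \sum_(c <- branches h l) 3^-1 * gw_weight R c * phi (low T y c) =
   \sum_(c <- branches h l) 3^-1 * gw_weight R c * 1 * reach_bound z +
   (1 - reach_bound z) * \sum_(c <- branches h l) 3^-1 * gw_weight R c * (low T y c)%:R.
  rewrite mulr_sumr -big_split /=; apply: eq_bigr => c _.
  by rewrite /phi; case: (low _ _ c) => /=; ring.
rewrite -mulr_suml.
have := reach_bound_le1 z; have := reach_bound_ge0 z.
rewrite /phi; nra.
Qed.

End Weights.

Lemma step_le T y m t m' : step T y (Some m) t = Some m' -> m' <= m.
Proof.
elim/ltree_indP: t m m' => l ts IH m m' /=; case: (leP m T) => [_ [->]//|Tm].
case: (ltP (y + l) m) => [lt_m|le_m].
  by case: ifP => [_ [<-]|_]; [exact: ltW|case: ifP => // _ [<-]; exact: ltW].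
elim: ts m {Tm le_m} IH => [|c ts IHts] m IH /=; first by case=> ->.
case E : (step T y (Some m) c) => [m1|]; last by rewrite foldl_step_None.
move=> /IHts h; apply: le_trans (IH c (mem_head _ _) _ _ E).
by apply: h => d dts; apply: IH; rewrite inE dts orbT.
Qed.

Lemma step_le_root T y m t m' : T < m -> step T y (Some m) t = Some m' ->
  m' <= y + root_label t.
Proof.
case: t => l ts Tm /= ; rewrite leNgt Tm /=; case: (ltP (y + l) m) => [lt_m|le_m].
  by case: ifP => [_ [<-]//|_]; case: ifP => // _ [<-].
move=> h; apply: le_trans le_m; apply: (@step_le T y m (Node (m - y) ts)) => /=.
by rewrite leNgt Tm /= addrC subrK ltxx.
Qed.

Section Exploration_bound.
Variable R : realType.
Variable T : int.

(* With d = m - T this is 1 - (d + 2) / (3 d), and (d + 2) / (3 d) is the product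
   over 1 <= z < d of 1 - reach_bound z: the remaining pruned subtrees are
   independent, one for each level between m and T. *)
Definition failure_bound (s : option int) : R :=
  if s is Some m then
    if m <= T then 0 else (2 * (m - T)%:~R - 2) / (3 * (m - T)%:~R)
  else 1.

Lemma failure_bound_ge0 s : 0 <= failure_bound s.
Proof.
case: s => [m|] /=; last exact: ler01.
case: (leP m T) => // Tm; have h : (1 : R) <= (m - T)%:~R by rewrite ler1z; lia.
by rewrite divr_ge0//; lra.
Qed.

Lemma failure_bound_le1 s : failure_bound s <= 1.
Proof.
case: s => [m|] //=; case: (leP m T) => [_|Tm]; first exact: ler01.
have h : (1 : R) <= (m - T)%:~R by rewrite ler1z; lia.
by rewrite ler_pdivrMr; lra.
Qed.

Lemma failure_bound_le23 m : failure_bound (Some m) <= 2 / 3.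
Proof.
rewrite /=; case: (leP m T) => [_|Tm]; first by rewrite divr_ge0.
have h : (1 : R) <= (m - T)%:~R by rewrite ler1z; lia.
by rewrite ler_pdivrMr; lra.
Qed.

(** At a new record [d] the exploration fails if the pruned subtree descends to [T], and otherwise
    resumes with record [d]. This identity is one factor of the telescoping product. *)
Lemma failure_bound_prune d : T < d ->
  reach_bound R (d - T) + (1 - reach_bound R (d - T)) * failure_bound (Some d) =
  failure_bound (Some (d + 1)).
Proof.
move=> Td; have Td1 : T < d + 1 by lia.
rewrite /failure_bound /reach_bound !leNgt subr_gt0 Td Td1 /=.
have h : (1 : R) <= (d - T)%:~R by rewrite ler1z; lia.
have -> : (d + 1 - T)%:~R = (d - T)%:~R + 1 :> R.
  by rewrite [d + 1 - T]addrAC (intrD _ (d - T)) mulr1z.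
set x : R := (d - T)%:~R in h *.
by field; repeat (apply/andP; split); apply: lt0r_neq0; lra.
Qed.

(** Because of [m - 1 <= y + l], a new record at the root is exactly [m - 1], and the pruning
    identity applies. If the root is not pruned, its children form a game whose payoff and value are
    both [failure_bound]. *)
Lemma trees_step_le y h l m : T < m -> m - 1 <= y + l ->
  \sum_(t <- trees h l) gw_weight R t * failure_bound (step T y (Some m) t) <=
  failure_bound (Some m).
Proof.
elim: h l m => [|h IH] l m Tm ml; first by rewrite big_nil failure_bound_ge0.
have [lt_m|le_m] := ltP (y + l) m.
  have lE : y + l = m - 1 by lia.
  have [xT|Tx] := leP (y + l) T.
    rewrite big1_seq ?failure_bound_ge0// => t /andP[_ /mapP[f _ ->]] /=.
    by rewrite leNgt Tm /= lt_m xT /= xT mulr0.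
  have mE : m = (y + l) + 1 by lia.
  rewrite {2}mE -(failure_bound_prune Tx).
  set u := reach_bound _ _; set v := failure_bound (Some (y + l)).
  have -> : \sum_(t <- trees h.+1 l) gw_weight R t * failure_bound (step T y (Some m) t) =
     \sum_(t <- trees h.+1 l) gw_weight R t * v +
     (1 - v) * \sum_(t <- trees h.+1 l) gw_weight R t * (low T y t)%:R.
    rewrite mulr_sumr -big_split /=; apply: eq_big_seq => t /mapP[f _ ->].
    rewrite [step _ _ _ _]/= leNgt Tm lt_m leNgt Tx [low _ _ _]/= leNgt Tx /=.
    by rewrite (fun_if failure_bound) -/v; case: (has _ f) => /=; ring.
  rewrite -mulr_suml.
  have := trees_low_le R T y h.+1 l; have := trees_mass_le1 R h.+1 l.
  have := failure_bound_ge0 (Some (y + l)); have := failure_bound_le1 (Some (y + l)).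
  rewrite -/u -/v; nra.
rewrite sum_trees.
under eq_bigr do rewrite [step _ _ _ _]/= leNgt Tm /= ltNge le_m /=.
(* The record stays at most the parent's label while the children are explored, so a child, at most
   one lower, again satisfies the hypothesis of the induction. *)
pose I (s : option int) := forall m', s = Some m' -> m' <= y + l.
apply: (@forest_supermartingale R (option int) I (step T y) failure_bound failure_bound) => //.
- exact: failure_bound_ge0.
- move=> [m1|] c Is m2; last by case: c.
  by move=> /step_le h2; apply: le_trans h2 _; apply: Is.
- move=> s Is; suff : \sum_(c <- branches h l) 3^-1 * gw_weight R c * failure_bound (step T y s c) <= failure_bound s by lra.
  rewrite (sum_branches _ _ (fun c => failure_bound (step T y s c))); apply: average_le => d ds.
  case: s Is => [m1|] Is.
    have [m1T|Tm1] := leP m1 T.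
      rewrite big1_seq ?failure_bound_ge0// => -[k f] _ /=.
      by rewrite m1T /= m1T mulr0.
    by apply: IH => //; have := Is _ (erefl _); move: ds; rewrite !inE => /or3P[] /eqP->; lia.
  rewrite (eq_bigr (gw_weight R)) ?trees_mass_le1// => -[k f] _.
  by rewrite [step _ _ _ _]/= mulr1.
- by move=> m' [<-].
Qed.

End Exploration_bound.

(** * Sums over words of fixed length, and the success of a window *)

Fixpoint words (A : Type) (s : seq A) n : seq (seq A) :=
  if n is n'.+1 then [seq x :: w | x <- s, w <- words s n'] else [:: [::]].

Lemma words_uniq (A : eqType) (s : seq A) n : uniq s -> uniq (words s n).
Proof.
move=> us; elim: n => //= n IH; apply: allpairs_uniq => //.
by move=> [x u] [y v] _ _ /= [-> ->].
Qed.

Lemma mem_words (A : eqType) (s : seq A) n w :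
  w \in words s n = (size w == n) && all (mem s) w.
Proof.
elim: n w => [|n IH] [|x w] //=; first by apply/negbTE/allpairsP => -[[]] ? ? [].
rewrite eqSS andbCA -IH; apply/allpairsP/andP => [[[y v]] /= [ys vs [-> ->]]//|[xs ws]].
by exists (x, w).
Qed.

Lemma sum_words (V : nmodType) (A : Type) (s : seq A) n (F : seq A -> V) :
  \sum_(w <- words s n.+1) F w = \sum_(x <- s) \sum_(w <- words s n) F (x :: w).
Proof. by rewrite /= big_allpairs_dep. Qed.

Lemma sum_words_prod (R : pzSemiRingType) (A : Type) (s : seq A) n (F : A -> R) :
  \sum_(w <- words s n) \prod_(x <- w) F x = (\sum_(x <- s) F x) ^+ n.
Proof.
elim: n => [|n IH]; first by rewrite big_seq1 big_nil.
rewrite sum_words exprS -IH mulr_suml; apply: eq_bigr => x _.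
by rewrite mulr_sumr; apply: eq_bigr => w _; rewrite big_cons.
Qed.

Lemma sum_undup_le (R : realFieldType) (A : eqType) (s : seq A) (F : A -> R) :
  (forall x, 0 <= F x) -> \sum_(x <- undup s) F x <= \sum_(x <- s) F x.
Proof.
move=> F0; elim: s => //= x s IH; rewrite [leRHS]big_cons.
case: ifP => _; last by rewrite big_cons lerD2l.
by apply: le_trans IH _; rewrite lerDr.
Qed.

Fixpoint hits (T x : int) (zs : seq int) : bool :=
  if zs is z :: zs' then (x <= T) || hits T (x + z) zs' else false.

Definition success (T : int) (zs : seq int) (ts : seq ltree) : bool :=
  if run T 0 (Some 1) zs ts is Some m then m <= T else false.

(** Unless the exploration fails, its record never exceeds the label of a spine vertex already
    explored. So a spine that descends to [T] leaves only two outcomes, success and failure. *)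
Lemma run_hits T x m zs ts m' : size zs = size ts -> all (fun t => root_label t == 0) ts ->
  hits T x zs -> run T x (Some m) zs ts = Some m' -> m' <= T.
Proof.
elim: zs ts x m => [|z zs IH] [|t ts] x m //= [hs] /andP[/eqP t0 hts] hh.
have [mT|Tm] := leP m T; first by case: t t0 => l us _ /=; rewrite mT run_stop// => -[<-].
case E : (step T x (Some m) t) => [m1|]; last by rewrite run_None.
case/orP: hh => [xT|hh]; last exact: IH.
have m1T : m1 <= T by have := step_le_root Tm E; rewrite t0; lia.
by rewrite run_stop// => -[<-].
Qed.

Section Success.
Variable R : realType.
Variable h : nat.
Let S := undup (trees h 0).
Let mass : R := \sum_(t <- S) gw_weight R t.

Lemma trees_root_good k l t : t \in trees k l -> root_label t = l /\ good_labels t.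
Proof.
elim: k l t => [|k IH] l t //= /mapP[f hf ->]; split=> //=.
have sub b g : g \in forests (branches k l) b -> forall c, c \in g -> c \in branches k l.
  elim: b g => [|b IHb] g /=; first by rewrite inE => /eqP->.
  rewrite inE => /predU1P[->//|/allpairsP[[c f'] /= [hc hf' ->]]] d.
  by rewrite inE => /predU1P[->//|]; exact: IHb hf' _.
move: (sub _ _ hf) => {sub}; elim: f {hf} => //= c f IHf hf; rewrite IHf ?andbT; last first.
  by move=> d df; apply: hf; rewrite inE df orbT.
have /flatten_mapP[d ds /IH[-> ->]] := hf c (mem_head _ _).
by rewrite andbT addrC addKr; move: ds; rewrite !inE => /or3P[] /eqP->.
Qed.

Lemma mass_le1 : mass <= 1.
Proof.
by apply: le_trans (trees_mass_le1 R h 0); apply: sum_undup_le => t; exact: gw_weight_ge0.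
Qed.

Lemma mass_ge0 : 0 <= mass.
Proof. by apply: sumr_ge0 => t _; exact: gw_weight_ge0. Qed.

Lemma run_failure_le T x m zs : all (fun z => `|z| <= 1) zs -> T < m -> m - 1 <= x ->
  \sum_(ts <- words S (size zs)) \prod_(t <- ts) gw_weight R t *
     failure_bound R T (run T x (Some m) zs ts) <= failure_bound R T (Some m).
Proof.
elim: zs x m => [|z zs IH] x m /=; first by rewrite big_seq1 big_nil mul1r.
move=> /andP[z1 hzs] Tm mx; rewrite big_allpairs_dep /=.
apply: le_trans (trees_step_le R h (y := x) (l := 0) Tm _); last by rewrite addr0.
apply: le_trans (sum_undup_le _ _); last first.
  by move=> t; rewrite mulr_ge0 ?gw_weight_ge0 ?failure_bound_ge0.
rewrite !big_seq; apply: ler_sum => t tS.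
under eq_bigr do rewrite big_cons -mulrA.
rewrite -mulr_sumr ler_wpM2l ?gw_weight_ge0//.
(* Once the exploration has stopped or failed the payoff is constant, and the remaining trees have
   total mass at most 1. *)
have const c : 0 <= c -> \sum_(ts <- words S (size zs)) \prod_(t <- ts) gw_weight R t * c <= c.
  move=> c0; rewrite -mulr_suml sum_words_prod ler_piMl// exprn_ile1 ?mass_ge0 ?mass_le1//.
case E : (step T x (Some m) t) => [m1|]; last first.
  by under eq_bigr do rewrite run_None; apply: const; exact: failure_bound_ge0.
have [m1T|Tm1] := leP m1 T.
  by under eq_bigr do rewrite run_stop//; apply: const; exact: failure_bound_ge0.
apply: IH => //; have := step_le_root Tm E.
have [-> _] : root_label t = 0 /\ good_labels t by move: tS; rewrite mem_undup => /trees_root_good.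
lia.
Qed.

Lemma success_ge T zs : T <= 0 -> all (fun z => `|z| <= 1) zs -> hits T 0 zs ->
  mass ^+ size zs - 2 / 3 <=
  \sum_(ts <- words S (size zs)) \prod_(t <- ts) gw_weight R t * (success T zs ts)%:R.
Proof.
move=> T0 zs1 hit; have := @run_failure_le T 0 1 zs zs1 ltac:(lia) ltac:(lia).
move=> /le_trans -/(_ _ (failure_bound_le23 R T 1)).
(* On a spine that hits [T], [failure_bound] of the final state is 1 minus the indicator of
   success. *)
have -> : \sum_(ts <- words S (size zs)) \prod_(t <- ts) gw_weight R t * (success T zs ts)%:R =
  mass ^+ size zs - \sum_(ts <- words S (size zs)) \prod_(t <- ts) gw_weight R t *
     failure_bound R T (run T 0 (Some 1) zs ts).
  rewrite /mass -sum_words_prod -sumrB; apply: eq_big_seq => ts.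
  rewrite mem_words => /andP[/eqP sts /allP hts]; rewrite -[X in X - _]mulr1 -mulrBr; congr (_ * _).
  rewrite /success; case E : (run _ _ _ _ _) => [m|] /=; last by rewrite subrr.
  suff -> : m <= T by rewrite subr0.
  apply: run_hits hit E; first by rewrite sts.
  apply/allP => t /hts /=; rewrite mem_undup => /trees_root_good[-> _] //.
by move=> ?; rewrite lerD2l lerN2.
Qed.

End Success.

Lemma mem_forests s b f : (f \in forests s b) = (size f <= b)%N && all (mem s) f.
Proof.
elim: b f => [|b IH] [|c f] //=; rewrite inE /=.
apply/allpairsP/idP => [[[c' f'] /= [hc hf [-> ->]]]|/and3P[h1 h2 h3]].
  by move: hf; rewrite IH => /andP[h1 h2]; apply/and3P.
by exists (c, f); rewrite /= IH h3 andbT.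
Qed.

Lemma trees_mono h h' l t : (h <= h')%N -> t \in trees h l -> t \in trees h' l.
Proof.
elim: h h' l t => [|h IH] [|h'] l t //= hh /mapP[f hf ->]; apply: map_f.
move: hf; rewrite !mem_forests => /andP[sf /allP ff]; apply/andP; split; first exact: (leq_trans sf (hh : (h <= h')%N)).
apply/allP => c /ff hc; have /flatten_mapP[k ks ck] : c \in branches h l by exact: hc.
suff : c \in branches h' l by [].
apply/flatten_mapP; exists k => //.
exact: IH ck.
Qed.

Lemma good_in_trees t : good_labels t -> exists h, t \in trees h (root_label t).
Proof.
elim/ltree_indP: t => l ts IH /= gt.
suff [h hh] : exists h, forall c, c \in ts -> c \in branches h l.
  exists (maxn h (size ts)).+1; apply: map_f; rewrite mem_forests leq_maxr /=.
  apply/allP => c /hh /flatten_mapP[k ks ck].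
  suff : c \in branches (maxn h (size ts)) l by [].
  apply/flatten_mapP; exists k => //.
  by apply: trees_mono ck; exact: leq_maxl.
elim: ts gt IH => [|c ts IHts] /=; first by exists 0%N.
move=> /and3P[hc gc gts] IH.
have [|h hh] := IHts gts; first by move=> d dts; apply: IH; rewrite inE dts orbT.
have [h' ch'] := IH c (mem_head _ _) gc.
exists (maxn h h') => d; rewrite inE => /predU1P[->|/hh /flatten_mapP[k ks dk]].
  apply/flatten_mapP; exists (root_label c - l).
    by rewrite !inE; move: hc; lia.
  by rewrite addrC subrK; apply: trees_mono ch'; exact: leq_maxr.
apply/flatten_mapP; exists k => //; apply: trees_mono dk; exact: leq_maxl.
Qed.


(** * The spine walk descends to every level *)

Section Survival.
Variables (R : realType) (T : int).

(** The probability that the first [n] positions of the spine walk from [x], the start included, are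
    all above [T]. *)
Fixpoint survival (n : nat) (x : int) : R :=
  if n is n'.+1 then
    if x <= T then 0 else 3^-1 * \sum_(d <- steps) survival n' (x + d)
  else 1.

Lemma survival_ge0 n x : 0 <= survival n x.
Proof.
elim: n x => [|n IH] x //=; case: ifP => // _.
by rewrite mulr_ge0 ?invr_ge0 ?sumr_ge0.
Qed.

Lemma survival_le1 n x : survival n x <= 1.
Proof. by elim: n x => [|n IH] x //=; case: ifP => // _; exact: average_le. Qed.

Lemma survival_le n x : survival n.+1 x <= survival n x.
Proof.
elim: n x => [|n IH] x.
  exact: survival_le1.
rewrite [leLHS]/= [leRHS]/=; case: ifP => // _; rewrite ler_wpM2l ?invr_ge0//.
by apply: ler_sum => d _; exact: IH.
Qed.

(* The limit is a bounded function that is linear above T. *)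
Lemma survival_cvg0 x : survival n x @[n --> \oo] --> (0 : R).
Proof.
have ni y : nonincreasing_seq (survival ^~ y).
  by apply/nonincreasing_seqP => n; exact: survival_le.
have lb y : has_lbound (range (survival ^~ y)).
  by exists 0 => _ [n _ <-]; exact: survival_ge0.
have cv y : cvgn (survival ^~ y) by exact: nonincreasing_is_cvgn.
pose h y := limn (survival ^~ y).
have hcv y : survival n y @[n --> \oo] --> h y by exact: cv.
have h0 y : 0 <= h y.
  by apply: limr_ge => //; apply: nearW => n; exact: survival_ge0.
have h1 y : h y <= 1.
  by apply: limr_le => //; apply: nearW => n; exact: survival_le1.
have hT y : y <= T -> h y = 0.
  move=> yT; apply/cvg_lim => //; rewrite -cvg_shiftS /=.
  by rewrite yT; exact: cvg_cst.
have harm y : T < y -> h y = 3^-1 * (h (y - 1) + h y + h (y + 1)).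
  move=> Ty; apply/cvg_lim => //; rewrite -cvg_shiftS.
  rewrite (_ : (fun n => _) = fun n => 3^-1 *
    (survival n (y - 1) + survival n y + survival n (y + 1))).
    by apply: cvgM; [exact: cvg_cst|apply: cvgD; [apply: cvgD|]; exact: hcv].
  apply/funext => n /=; rewrite leNgt Ty /= /steps !big_cons big_nil /=.
  by rewrite addr0 !addr0 addrA.
have lin (k : nat) : h (T + k%:Z) = k%:R * h (T + 1) /\ h (T + k.+1%:Z) = k.+1%:R * h (T + 1).
  elim: k => [|k [IH1 IH2]]; first by rewrite addr0 hT// mul0r mul1r.
  split=> //; have := harm (T + k.+1%:Z); rewrite ltrDl => /(_ isT).
  have -> : T + k.+1%:Z - 1 = T + k%:Z by lia.
  have -> : T + k.+1%:Z + 1 = T + k.+2%:Z by lia.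
  rewrite IH1 IH2 -[k.+2%:R]/((2 + k)%:R) -[k.+1%:R]/((1 + k)%:R) !natrD; lra.
have hT1 : h (T + 1) = 0.
  apply/eqP; rewrite eq_le h0 andbT leNgt; apply/negP => hpos.
  have [k] : exists k : nat, (h (T + 1))^-1 < k%:R.
    by exists (Num.truncn (h (T + 1))^-1).+1; exact: truncnS_gt.
  rewrite -(ltr_pM2r hpos) mulVf ?gt_eqF// -(lin k).1 ltNge h1//.
suff <- : h x = 0 by [].
have [xT|Tx] := leP x T; first exact: hT.
have -> : x = T + (absz (x - T))%:Z by lia.
by rewrite (lin _).1 hT1 mulr0.
Qed.

Lemma sum_not_hits n x :
  \sum_(zs <- words steps n) (3^-1) ^+ n * (~~ hits T x zs)%:R = survival n x.
Proof.
elim: n x => [|n IH] x; first by rewrite big_seq1 mulr1.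
rewrite sum_words /=; case: ifP => [xT|xT].
  by rewrite big1 // => d _; rewrite big1 // => zs _; rewrite mulr0.
rewrite mulr_sumr; apply: eq_bigr => d _; rewrite -IH mulr_sumr.
by apply: eq_bigr => zs _; rewrite exprS mulrA.
Qed.

End Survival.

Definition cut_window (T : int) (zs : seq int) (ts ts' : seq ltree) : bool :=
  success T zs ts && (first_low T 0 zs ts <= first_low T 0 zs ts')%N.

Lemma sum_steps_words (R : realType) n : \sum_(zs <- words steps n) (3^-1) ^+ n = 1 :> R.
Proof.
elim: n => [|n IH]; first by rewrite big_seq1.
rewrite sum_words.
under eq_bigr do (under eq_bigr do rewrite exprS); under eq_bigr do rewrite -mulr_sumr IH.
by rewrite /steps !big_cons big_nil; lra.
Qed.

(* Given the spine, success on the left and success for the right trees are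
   independent and equally likely (>= 1/4), and by symmetry first_low for the
   left trees is the smaller one in at least half of the cases. *)
Lemma cut_window_sum (R : realType) (h n : nat) (T : int) :
  T <= 0 -> survival R T n 0 <= 2^-1 ->
  11 / 12 <= (\sum_(t <- undup (trees h 0)) gw_weight R t) ^+ n ->
  64^-1 <= \sum_(zs <- words steps n) \sum_(ts <- words (undup (trees h 0)) n)
    \sum_(ts' <- words (undup (trees h 0)) n)
     (3^-1) ^+ n * \prod_(t <- ts) gw_weight R t * \prod_(t <- ts') gw_weight R t *
     (cut_window T zs ts ts')%:R.
Proof.
set S := undup _ => T0 sv mass.
pose w (ts : seq ltree) : R := \prod_(t <- ts) gw_weight R t.
have w0 ts : 0 <= w ts by apply: prodr_ge0 => t _; exact: gw_weight_ge0.
have inner zs : zs \in words steps n ->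
   32^-1 * ((3^-1) ^+ n * (hits T 0 zs)%:R) <=
   \sum_(ts <- words S n) \sum_(ts' <- words S n)
     (3^-1) ^+ n * w ts * w ts' * (cut_window T zs ts ts')%:R.
  rewrite mem_words => /andP[/eqP szs hzs].
  have zs1 : all (fun z => `|z| <= 1) zs.
    by apply: sub_all hzs => z /=; rewrite !inE => /or3P[] /eqP->.
  set J := leRHS.
  have JE : 2 * J = \sum_(ts <- words S n) \sum_(ts' <- words S n)
     (3^-1) ^+ n * w ts * w ts' * ((cut_window T zs ts ts')%:R + (cut_window T zs ts' ts)%:R).
    rewrite mulrDl mul1r {2}/J exchange_big -big_split; apply: eq_bigr => ts _.
    rewrite -big_split; apply: eq_bigr => ts' _ /=; ring.
  case: (boolP (hits T 0 zs)) => hit; last first.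
    rewrite !mulr0; apply: sumr_ge0 => ts _; apply: sumr_ge0 => ts' _.
    by rewrite !mulr_ge0 ?exprn_ge0 ?invr_ge0.
  pose L := \sum_(ts <- words S n) w ts * (success T zs ts)%:R.
  (* Here [1 / 4 = 11 / 12 - 2 / 3]. Success on both sides then has weight at least 1/16, symmetry
     halves this to 1/32, and spines that hit [T] have total weight at least 1/2, which gives
     1/64. *)
  have hL : 1 / 4 <= L.
    have := success_ge R h T0 zs1 hit; rewrite szs -/S; apply: le_trans.
    by move: mass; rewrite -/S; lra.
  have : (3^-1) ^+ n * (L * L) <= 2 * J.
    rewrite JE /L mulr_suml mulr_sumr; apply: ler_sum => ts _.
    rewrite mulrA mulr_sumr; apply: ler_sum => ts' _.
    have -> : 3^-1 ^+ n * (w ts * (success T zs ts)%:R) * (w ts' * (success T zs ts')%:R) =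
       3^-1 ^+ n * w ts * w ts' * ((success T zs ts)%:R * (success T zs ts')%:R) by ring.
    rewrite ler_wpM2l ?mulr_ge0 ?exprn_ge0 ?invr_ge0// /cut_window.
    case: (success T zs ts) (success T zs ts') => -[] /=; rewrite ?mul0r ?mulr0 ?mul1r ?addr_ge0//.
    rewrite -natrD ler1n; have := leq_total (first_low T 0 zs ts) (first_low T 0 zs ts').
    by move: (_ <= _)%N (_ <= _)%N => [] [].
  have hLL : 1 / 16 <= L * L by nra.
  have c0 : 0 <= (3^-1) ^+ n :> R by rewrite exprn_ge0.
  rewrite mulr1; move: (3^-1 ^+ n) c0 => c c0; nra.
have : 64^-1 <= \sum_(zs <- words steps n) 32^-1 * ((3^-1) ^+ n * (hits T 0 zs)%:R) :> R.
  rewrite -mulr_sumr.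
  have -> : \sum_(zs <- words steps n) (3^-1) ^+ n * (hits T 0 zs)%:R = 1 - survival R T n 0.
    apply/eqP; rewrite eq_sym subr_eq -[X in X == _](sum_steps_words R n) -sum_not_hits -big_split /=; apply/eqP.
    by apply: eq_bigr => zs _; case: hits; rewrite /= !(mulr1, mulr0, addr0, add0r).
  by move: sv; lra.
move=> /le_trans; apply; rewrite big_seq [leRHS]big_seq; apply: ler_sum => zs.
exact: inner.
Qed.

(** * Cut vertices occur at arbitrarily low levels *)

Section Discrete.
Context d (Omega : measurableType d) (R : realType) (P : probability Omega R).

(** The values carry no sigma-algebra: a random variable enters only through its atoms, and
    countability of the values gives all other events. *)
Definition discrete (A : Type) (f : Omega -> A) :=
  forall x, measurable [set w | f w = x].

Lemma discrete_preimage (A : countType) (f : Omega -> A) (S : set A) :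
  discrete f -> measurable (f @^-1` S).
Proof.
move=> df; rewrite (_ : f @^-1` S = \bigcup_x ([set w | f w = x] `&` [set w | S x])).
  apply: countable_bigcupT_measurable => [|x]; first exact: countableP.
  apply: measurableI; first exact: df.
  have [Sx|nSx] := pselect (S x).
    by rewrite (_ : mkset _ = setT); [exact: measurableT|apply/seteqP; split].
  by rewrite (_ : mkset _ = set0); [exact: measurable0|apply/seteqP; split].
by apply/seteqP; split => [w Sw|w [x _ [/= -> ]]//]; exists (f w).
Qed.

Lemma discrete_pair (A B : Type) (f : Omega -> A) (g : Omega -> B) :
  discrete f -> discrete g -> discrete (fun w => (f w, g w)).
Proof.
move=> df dg [x y]; rewrite (_ : mkset _ = [set w | f w = x] `&` [set w | g w = y]).
  by apply: measurableI; [exact: df|exact: dg].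
by apply/seteqP; split => w /= [-> ->].
Qed.

Lemma discrete_mkseq (A : Type) (f : nat -> Omega -> A) n :
  (forall i, discrete (f i)) -> discrete (fun w => mkseq (f ^~ w) n).
Proof.
move=> df; elim: n => [|n IH] s.
  case: s => [|x s]; first by rewrite (_ : mkset _ = setT); [exact: measurableT|apply/seteqP; split].
  by rewrite (_ : mkset _ = set0); [exact: measurable0|apply/seteqP; split].
case/lastP: s => [|s x].
  rewrite (_ : mkset _ = set0); first exact: measurable0.
  by apply/seteqP; split.
rewrite (_ : mkset _ = [set w | mkseq (f ^~ w) n = s] `&` [set w | f n w = x]).
  by apply: measurableI; [exact: IH|exact: df].
apply/seteqP; split => w /=; rewrite mkseqS; last by move=> [-> ->].
by move=> /rcons_inj[-> ->].
Qed.

Lemma discrete_indep (A : countType) (f : Omega -> A) (C : set Omega) (p : R) :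
  discrete f -> measurable C -> 
  (forall x, P ([set w | f w = x] `&` C) = (P [set w | f w = x] * p%:E)%E) ->
  forall S : set A, P (f @^-1` S `&` C) = (P (f @^-1` S) * p%:E)%E.
Proof.
move=> df mC h S; pose D := pickle @` S; pose F n := [set w | pickle (f w) = n].
have mF n : measurable (F n) by exact: (discrete_preimage (fun x => pickle x = n)).
have E : f @^-1` S = \bigcup_(n in D) F n.
  apply/seteqP; split => [w Sw|w [_ [x Sx <-]]]; first by exists (pickle (f w)) => //; exists (f w).
  by move=> /(pcan_inj pickleK) /= fx; rewrite /= fx.
have FE n : D n -> exists x, F n = [set w | f w = x].
  move=> [x _ <-]; exists x; apply/seteqP; split => w; last by move=> /= <-.
  by move=> /(pcan_inj pickleK).
have tF : trivIset D F by move=> i j _ _ [w [<- <-]].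
rewrite E setI_bigcupl measure_bigcup; first last.
- by move=> i j _ _ [w [[<- _] [<- _]]].
- by move=> n _; exact: measurableI.
rewrite measure_bigcup// muleC -nneseriesZl//.
apply: eq_eseriesr => n /set_mem /FE[x xE].
rewrite muleC -[RHS]/(P (F n) * _)%E -[LHS]/(P (F n `&` C)) xE.
exact: h.
Qed.

Lemma prob_mem_seq (A : countType) (f : Omega -> A) (E : set Omega) (s : seq A) :
  discrete f -> measurable E -> uniq s ->
  P (E `&` [set w | f w \in s]) = (\sum_(x <- s) P (E `&` [set w | f w = x]))%E.
Proof.
move=> df mE; elim: s => [|x s IH] /=.
  by rewrite big_nil (_ : _ `&` _ = set0) ?measure0//; apply/seteqP; split => // w [].
move=> /andP[xs us]; rewrite big_cons -IH// -measureU//.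
- congr (P _); apply/seteqP; split => w /=.
    by move=> [Ew]; rewrite inE => /predU1P[->|h]; [left|right].
  by move=> [[Ew ->]|[Ew h]]; split => //; rewrite inE ?eqxx ?h ?orbT.
- by apply: measurableI.
- by apply: measurableI => //; exact: (discrete_preimage (fun x => x \in s)).
- by apply/seteqP; split => // w [[_ /= ->] [_ /=]]; rewrite (negbTE xs).
Qed.

Lemma discrete_null (A : countType) (f : Omega -> A) (S : set A) :
  discrete f -> (forall x, S x -> P [set w | f w = x] = 0%E) -> P (f @^-1` S) = 0%E.
Proof.
move=> df S0; have mS := discrete_preimage S df.
(* The event itself serves as [C], with [p = 0]: an atom either lies in it, and is null, or is
   disjoint from it. *)
rewrite -(setIid (f @^-1` S)) (@discrete_indep _ f _ 0)// ?mule0// => x; rewrite mule0.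
have [Sx|nSx] := pselect (S x).
  apply/eqP; rewrite eq_le measure_ge0 andbT -(S0 _ Sx).
  by apply: measureIl => //; exact: df.
by rewrite (_ : _ `&` _ = set0) ?measure0//; apply/seteqP; split => // w [/= ->].
Qed.

End Discrete.

Lemma InP (A : eqType) (x : A) (s : seq A) : reflect (List.In x s) (x \in s).
Proof.
apply: (iffP idP); elim: s => //= y s IH; first by rewrite inE => /predU1P[->|/IH]; [left|right].
by move=> [->|/IH xs]; rewrite inE ?eqxx// xs orbT.
Qed.

Lemma uniq_NoDup (A : eqType) (s : seq A) : uniq s -> List.NoDup s.
Proof.
elim: s => [_|x s IH /= /andP[xs us]]; constructor; last exact: IH.
by move/InP; exact/negP.
Qed.

(** * Law and independence of the windows of the process *)

Section Probability.
Context d (Omega : measurableType d) (R : realType) (P : probability Omega R).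
Variables (xi : nat -> Omega -> int) (Lt Rt : nat -> Omega -> ltree) (eta : Omega -> bool).
Hypothesis mxi : forall n z, measurable [set w | xi n w = z].
Hypothesis mL : forall n t, measurable [set w | Lt n w = t].
Hypothesis mR : forall n t, measurable [set w | Rt n w = t].
Hypothesis lawxi : forall n z, P [set w | xi n w = z] = (if `|z| <= 1 then 3^-1 else 0)%:E.
Hypothesis lawL : forall n t, P [set w | Lt n w = t] = (rho0 R t)%:E.
Hypothesis lawR : forall n t, P [set w | Rt n w = t] = (rho0 R t)%:E.
Hypothesis indep : mutually_independent P xi Lt Rt eta.

Let state : countType := (seq int * seq ltree * seq ltree)%type.

Definition history (a n : nat) (w : Omega) : state :=
  (mkseq (fun i => xi (a + i)%N w) n, mkseq (fun i => Lt (a + i)%N w) n,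
   mkseq (fun i => Rt (a + i)%N w) n).

Lemma discrete_history a n : discrete (history a n).
Proof. by do !apply: discrete_pair; apply: discrete_mkseq => i x; [exact: mxi|exact: mL|exact: mR]. Qed.

Definition weight (c : state) : R :=
  \prod_(z <- c.1.1) (if `|z| <= 1 then 3^-1 else 0) *
  \prod_(t <- c.1.2) rho0 R t * \prod_(t <- c.2) rho0 R t.

Definition sized n (c : state) := [&& size c.1.1 == n, size c.1.2 == n & size c.2 == n].

Definition atoms n (c : state) : seq atom :=
  [seq AXi i (nth 0 c.1.1 i) | i <- iota 0 n] ++
  [seq AL i (nth leaf c.1.2 i) | i <- iota 0 n] ++
  [seq AR i (nth leaf c.2 i) | i <- iota 0 n].

Let idx_code (j : idx) : nat * nat :=
  match j with IXi n => (0, n) | IL n => (1, n) | IR n => (2, n) | IEta => (3, 0) end%N.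

Lemma NoDup_atoms n c : List.NoDup (map atom_idx (atoms n c)).
Proof.
apply: (List.NoDup_map_inv idx_code).
rewrite -[List.map idx_code _]/(map idx_code (map atom_idx (atoms n c))) -map_comp.
apply: uniq_NoDup; rewrite !map_cat -!map_comp !cat_uniq.
rewrite !map_inj_uniq ?iota_uniq//=; try by move=> i j [].
rewrite !andbT; apply/andP; split; apply/hasPn => x /=; rewrite ?mem_cat.
  by move=> /orP[] /mapP[i _ ->]; apply/mapP => -[].
by move=> /mapP[i _ ->]; apply/mapP => -[].
Qed.

Lemma prob_history0 n c : sized n c -> P [set w | history 0 n w = c] = (weight c)%:E.
Proof.
case: c => -[zs ts] ts' /and3P[/eqP/= szs /eqP/= sts /eqP/= sts'].
have -> : [set w | history 0 n w = (zs, ts, ts')] =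
  [set w | forall a, List.In a (atoms n (zs, ts, ts')) -> atom_ev xi Lt Rt eta a w].
  apply/seteqP; split => w /=.
    move=> [<- <- <-] a; rewrite !List.in_app_iff !List.in_map_iff.
    have lt_n i : List.In i (iota 0 n) -> (i < n)%N by move=> /InP; rewrite mem_iota.
    by move=> [[i [<- /lt_n hi]]|[[i [<- /lt_n hi]]|[i [<- /lt_n hi]]]] /=; rewrite nth_mkseq.
  move=> h.
  have In_l i : (i < n)%N -> List.In i (iota 0 n) by move=> hi; apply/InP; rewrite mem_iota.
  congr (_, _, _).
  - rewrite -[RHS](mkseq_nth 0) szs; apply/eq_in_map => i; rewrite mem_iota => /= /In_l hi.
    apply: (h (AXi i (nth 0 zs i))); apply/List.in_app_iff; left.
    exact: (List.in_map (fun i => AXi i (nth 0 zs i))).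
  - rewrite -[RHS](mkseq_nth leaf) sts; apply/eq_in_map => i; rewrite mem_iota => /= /In_l hi.
    apply: (h (AL i (nth leaf ts i))); apply/List.in_app_iff; right; apply/List.in_app_iff; left.
    exact: (List.in_map (fun i => AL i (nth leaf ts i))).
  - rewrite -[RHS](mkseq_nth leaf) sts'; apply/eq_in_map => i; rewrite mem_iota => /= /In_l hi.
    apply: (h (AR i (nth leaf ts' i))); apply/List.in_app_iff; right; apply/List.in_app_iff; right.
    exact: (List.in_map (fun i => AR i (nth leaf ts' i))).
rewrite indep; last exact: NoDup_atoms.
rewrite /atoms !big_cat !big_map /= /weight /= mulrA.
congr (_ * _ * _)%:E.
- rewrite -[in RHS](mkseq_nth 0 zs) szs big_map; apply: eq_bigr => i _.
  by rewrite /= lawxi.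
- rewrite -[in RHS](mkseq_nth leaf ts) sts big_map; apply: eq_bigr => i _.
  by rewrite /= lawL.
- rewrite -[in RHS](mkseq_nth leaf ts') sts' big_map; apply: eq_bigr => i _.
  by rewrite /= lawR.
Qed.

Definition cat_state (c c' : state) : state :=
  (c.1.1 ++ c'.1.1, c.1.2 ++ c'.1.2, c.2 ++ c'.2).

Lemma weight_cat c c' : weight (cat_state c c') = weight c * weight c'.
Proof. by rewrite /weight !big_cat /=; ring. Qed.

Lemma history_cat a n w : history 0 (a + n) w = cat_state (history 0 a w) (history a n w).
Proof.
have E : iota a n = [seq (a + i)%N | i <- iota 0 n] by rewrite -iotaDl addn0.
by rewrite /cat_state /history /= /mkseq iotaD add0n !map_cat E -!map_comp.
Qed.

Lemma sized_history a n w : sized n (history a n w).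
Proof. by rewrite /sized /= !size_mkseq !eqxx. Qed.

Lemma cat_state_inj n c1 c1' c2 c2' : sized n c1 -> sized n c2 ->
  cat_state c1 c1' = cat_state c2 c2' -> c1 = c2 /\ c1' = c2'.
Proof.
case: c1 c1' c2 c2' => -[a b] c [[a' b'] c'] [[e f] g] [[e' f'] g'].
move=> /and3P[/eqP/= h1 /eqP/= h2 /eqP/= h3] /and3P[/eqP/= h4 /eqP/= h5 /eqP/= h6] [].
move=> /eqP; rewrite eqseq_cat ?h1 ?h4// => /andP[/eqP-> /eqP->].
move=> /eqP; rewrite eqseq_cat ?h2 ?h5// => /andP[/eqP-> /eqP->].
by move=> /eqP; rewrite eqseq_cat ?h3 ?h6// => /andP[/eqP-> /eqP->].
Qed.

(** The past and the window together form [history 0 (a + n)], whose weight factors; a full [S]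
    gives the law of the shifted window. *)
Lemma prob_history_indep a n (S : set state) c : sized n c ->
  P (history 0 a @^-1` S `&` [set w | history a n w = c]) =
  (P (history 0 a @^-1` S) * (weight c)%:E)%E.
Proof.
move=> hc; apply: discrete_indep; [exact: discrete_history|exact: discrete_history|].
move=> x; have [hx|hx] := boolP (sized a x); last first.
  have -> : [set w | history 0 a w = x] = set0.
    by apply/seteqP; split => // w /= E; move: hx; rewrite -E sized_history.
  by rewrite set0I measure0 mul0e.
rewrite prob_history0// -EFinM -weight_cat -(@prob_history0 (a + n)); last first.
  case/and3P: hx hc => /eqP a1 /eqP a2 /eqP a3 /and3P[/eqP b1 /eqP b2 /eqP b3].
  by rewrite /sized /= !size_cat a1 a2 a3 b1 b2 b3 !eqxx.
congr (P _); apply/seteqP; split => w /=; rewrite history_cat; first by move=> [-> ->].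
by move=> /(cat_state_inj (sized_history 0 a w) hx).
Qed.

Lemma good_ae : P.-negligible (~` [set w | forall n, [/\ `|xi n w| <= 1,
  root_label (Lt n w) = 0 /\ good_labels (Lt n w) &
  root_label (Rt n w) = 0 /\ good_labels (Rt n w)]]).
Proof.
pose Z := [set z : int | ~~ (`|z| <= 1)].
pose B := [set t : ltree | ~~ ((root_label t == 0) && good_labels t)].
apply: (@negligibleS _ _ _ _ (\bigcup_n ((xi n @^-1` Z `|` Lt n @^-1` B) `|` Rt n @^-1` B))).
  move=> w /= /existsNP[n h]; exists n => //=; apply: contrapT => h'; apply: h.
  move: h'; rewrite /Z /B /= => /not_orP[/not_orP[/negP + /negP +] /negP].
  by rewrite !negbK => -> /andP[/eqP-> ->] /andP[/eqP-> ->].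
have B0 t : B t -> rho0 R t = 0 by rewrite /B /rho0 /= => /negbTE ->.
apply: negligible_bigcup => n; apply: negligibleU; first apply: negligibleU.
- apply/negligibleP; first exact: (discrete_preimage _ (mxi n)).
  apply: discrete_null (mxi n) _ => z; rewrite /Z /= => /negbTE h.
  by rewrite lawxi h.
- apply/negligibleP; first exact: (discrete_preimage _ (mL n)).
  by apply: discrete_null (mL n) _ => t /B0 h; rewrite lawL h.
- apply/negligibleP; first exact: (discrete_preimage _ (mR n)).
  by apply: discrete_null (mR n) _ => t /B0 h; rewrite lawR h.
Qed.

Lemma sum_trees_prob h :
  ((\sum_(t <- undup (trees h 0)) gw_weight R t)%:E = P [set w | Lt 0 w \in trees h 0])%E.
Proof.
rewrite -[X in P X]setTI (_ : [set w | Lt 0 w \in trees h 0] = [set w | Lt 0 w \in undup (trees h 0)]).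
  rewrite (prob_mem_seq P (mL 0) (@measurableT _ _))// ?undup_uniq// -sumEFin.
  apply: eq_big_seq => t; rewrite mem_undup => /trees_root_good[t0 gt].
  by rewrite setTI lawL /rho0 t0 gt eqxx.
by apply/seteqP; split => w /=; rewrite mem_undup.
Qed.

(** The total mass of the tree law is not computed. The sums are probabilities of increasing events,
    whose union is almost sure since every good tree with root label 0 lies in some [trees h 0]. *)
Lemma sum_trees_cvg1 :
  (\sum_(t <- undup (trees h 0)) gw_weight R t @[h --> \oo] --> (1 : R)).
Proof.
have mA h : measurable [set w | Lt 0 w \in trees h 0].
  exact: (discrete_preimage (fun t => t \in trees h 0) (mL 0)).
pose A h := [set w | Lt 0 w \in trees h 0].
have mU : measurable (\bigcup_h A h) by exact: bigcupT_measurable.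
have PU : P (\bigcup_h A h) = 1%E.
  rewrite -[X in P X]setCK probability_setC; last exact: measurableC.
  rewrite (_ : P (~` _) = 0%E) ?sube0//; apply/negligibleP; first exact: measurableC.
  apply: negligibleS good_ae => w /= nA h; apply: nA.
  have [_ [r0 g] _] := h 0%N; have [k hk] := good_in_trees g.
  by exists k => //; rewrite /A /= -r0.
have : (P \o A) h @[h --> \oo] --> P (\bigcup_h A h).
  apply: nondecreasing_cvg_mu => // i j ij; apply/subsetPset => w /=.
  exact: trees_mono.
rewrite PU => /fine_cvg; apply: cvg_trans; apply: near_eq_cvg.
by apply: nearW => h /=; rewrite -sum_trees_prob.
Qed.

Lemma exists_window (T : int) : T <= 0 -> exists n h,
  survival R T n 0 <= 2^-1 /\
  11 / 12 <= (\sum_(t <- undup (trees h 0)) gw_weight R t) ^+ n.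
Proof.
move=> T0; have [n hn] : exists n, survival R T n 0 <= 2^-1.
  have /cvgrPdist_lt /(_ 2^-1) := @survival_cvg0 R T 0.
  rewrite invr_gt0 ltr0n => /(_ isT) [n _ /(_ n (leqnn n))] /=.
  by rewrite sub0r normrN ger0_norm ?survival_ge0// => /ltW; exists n.
(* [h] is chosen after [n], because the truncated mass is raised to the power [n]. *)
exists n.
have : (\sum_(t <- undup (trees h 0)) gw_weight R t) ^+ n @[h --> \oo] --> (1 ^+ n : R).
  by apply: (@cvg_comp _ _ _ _ (fun x : R => x ^+ n)); [exact: sum_trees_cvg1|exact: exprn_continuous].
rewrite expr1n => /cvgrPdist_lt /(_ 12^-1); rewrite invr_gt0 ltr0n => /(_ isT) [h _ /(_ h (leqnn h))] /=.
rewrite ltr_norml => /andP[_ hh]; exists h; split => //; lra.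
Qed.

Lemma weight_ge0 c : 0 <= weight c.
Proof.
have rho0_ge0 t : 0 <= rho0 R t by rewrite /rho0; case: ifP => // _; exact: gw_weight_ge0.
rewrite /weight !mulr_ge0 ?prodr_ge0// => z _.
by case: ifP => // _; rewrite invr_ge0.
Qed.

Definition cut_event (a n K : nat) (w : Omega) : bool :=
  let c := history a n w in cut_window (- Posz K) c.1.1 c.1.2 c.2.

(** [n] is chosen before [S]: the bound is uniform over all events of the past, which replaces a
    conditional probability. *)
Lemma cut_event_ge (a K : nat) : exists n, forall S : set state,
  (P (history 0 a @^-1` S) * (64^-1)%:E <=
   P (history 0 a @^-1` S `&` [set w | cut_event a n K w]))%E.
Proof.
have T0 : - Posz K <= 0 by lia.
have [n [h [hs hm]]] := exists_window T0; exists n => S.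
set V := undup (trees h 0) in hm.
pose C : seq state := [seq (p, ts') | p <- [seq (zs, ts) | zs <- words steps n, ts <- words V n],
  ts' <- words V n].
pose cut (c : state) := cut_window (- Posz K) c.1.1 c.1.2 c.2.
have uV : uniq V by exact: undup_uniq.
have uC : uniq ([seq c <- C | cut c]).
  apply: filter_uniq; apply: allpairs_uniq; [|exact: words_uniq|by move=> [? ?] [? ?] _ _ [-> ->]].
  by apply: allpairs_uniq; [exact: words_uniq|exact: words_uniq|move=> [? ?] [? ?] _ _ [-> ->]].
have mE : measurable (history 0 a @^-1` S) by exact: (discrete_preimage S (discrete_history 0 a)).
apply: (@le_trans _ _ (P (history 0 a @^-1` S `&` [set w | history a n w \in [seq c <- C | cut c]]))); last first.
  apply: le_measure; rewrite ?inE.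
  - apply: measurableI => //.
    exact: (discrete_preimage (fun c => c \in [seq c <- C | cut c]) (discrete_history a n)).
  - by apply: measurableI => //; exact: (discrete_preimage cut (discrete_history a n)).
  - by move=> w [Ew /=]; rewrite mem_filter => /andP[cw _]; split.
rewrite (prob_mem_seq P (discrete_history a n) mE uC).
have CE c : c \in C -> sized n c /\ weight c = (3^-1) ^+ n * \prod_(t <- c.1.2) gw_weight R t * \prod_(t <- c.2) gw_weight R t.
  move=> /allpairsP[[p ts'] /= [/allpairsP[[zs ts] /= [hz ht ->]] ht' ->]] /=.
  move: hz ht ht'; rewrite !mem_words => /andP[/eqP sz az] /andP[/eqP st at_] /andP[/eqP st' at'].
  split; first by rewrite /sized /= sz st st' !eqxx.
  have rho_gw s : all (mem V) s -> \prod_(t <- s) rho0 R t = \prod_(t <- s) gw_weight R t.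
    move=> /allP hsV; apply: eq_big_seq => t /hsV /=; rewrite mem_undup => /trees_root_good[t0 gt].
    by rewrite /rho0 t0 gt eqxx.
  rewrite /weight /= !rho_gw//; congr (_ * _ * _).
  rewrite -sz; elim: zs az {sz} => [|z zs IH] /=; first by rewrite big_nil.
  move=> /andP[hz hzs]; rewrite big_cons IH// exprS.
  by congr (_ * _); move: hz; rewrite !inE => /or3P[] /eqP->.
rewrite (eq_big_seq (fun c => P (history 0 a @^-1` S) * (weight c)%:E)%E); last first.
  by move=> c; rewrite mem_filter => /andP[_ /CE[sc _]]; exact: prob_history_indep.
rewrite -ge0_sume_distrr; last first.
  by move=> c _; rewrite lee_fin; exact: weight_ge0.
apply: lee_wpmul2l; first exact: measure_ge0.
rewrite sumEFin lee_fin; apply: le_trans (cut_window_sum T0 hs hm) _.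
rewrite big_filter [leRHS](_ : _ = \sum_(c <- C) (3^-1) ^+ n *
  \prod_(t <- c.1.2) gw_weight R t * \prod_(t <- c.2) gw_weight R t * (cut c)%:R).
  by rewrite /C !big_allpairs_dep.
rewrite big_mkcond; apply: eq_big_seq => c /CE[_ ->].
by case: ifP => _; rewrite ?mulr1 ?mulr0.
Qed.


Definition past_event (a K N : nat) (w : Omega) : bool :=
  let X := Xs (fun i => xi i w) in
  all (fun i => ~~ low (X a - Posz K) (X i) (Lt i w) && ~~ low (X a - Posz K) (X i) (Rt i w))
    (iota 0 a) && (X a - Posz K <= - Posz N).

Definition good_event (a n K N : nat) (w : Omega) : bool :=
  [&& (0 < a)%N, past_event a K N w & cut_event a n K w].

(** An event of the first [m] spine steps and trees. It is a preimage under [history 0 m], so the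
    bounds on later windows apply to it. *)
Definition determined (m : nat) (S : set Omega) :=
  forall w w', history 0 m w = history 0 m w' -> S w -> S w'.

Lemma determined_preimage m S : determined m S ->
  S = history 0 m @^-1` (history 0 m @` S).
Proof.
move=> dS; apply/seteqP; split => [w Sw|w [w' Sw' E]]; first by exists w.
exact: dS E Sw'.
Qed.

Lemma determined_measurable m S : determined m S -> measurable S.
Proof.
by move=> /determined_preimage ->; apply: discrete_preimage; exact: discrete_history.
Qed.

Lemma history_nth m w w' i : history 0 m w = history 0 m w' -> (i < m)%N ->
  [/\ xi i w = xi i w', Lt i w = Lt i w' & Rt i w = Rt i w'].
Proof.
move=> [h1 h2 h3] im; split.
- by move/(congr1 (nth 0 ^~ i)): h1; rewrite !nth_mkseq.
- by move/(congr1 (nth leaf ^~ i)): h2; rewrite !nth_mkseq.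
- by move/(congr1 (nth leaf ^~ i)): h3; rewrite !nth_mkseq.
Qed.

Lemma history_sub m a n w w' : history 0 m w = history 0 m w' -> (a + n <= m)%N ->
  history a n w = history a n w'.
Proof.
move=> h anm; have hi i : (i < n)%N -> (a + i < m)%N.
  by move=> hi; apply: leq_trans anm; rewrite ltn_add2l.
by congr (_, _, _); apply/eq_in_map => i; rewrite mem_iota => /= /hi /(history_nth h)[].
Qed.

Lemma past_event_determined m a K N w w' : history 0 m w = history 0 m w' -> (a <= m)%N ->
  past_event a K N w = past_event a K N w'.
Proof.
move=> h am; have XE i : (i <= a)%N -> Xs (fun k => xi k w) i = Xs (fun k => xi k w') i.
  move=> ia; apply: eq_bigr => k _.
  by have [] := history_nth h (leq_trans (leq_trans (ltn_ord k) ia) am).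
rewrite /past_event XE//; congr (_ && _); apply: eq_in_all => i; rewrite mem_iota => /= ia.
have [_ -> ->] := history_nth h (leq_trans ia am).
by rewrite XE // ltnW.
Qed.

Lemma good_event_determined m a n K N w w' : history 0 m w = history 0 m w' -> (a + n <= m)%N ->
  good_event a n K N w = good_event a n K N w'.
Proof.
move=> h anm; rewrite /good_event (past_event_determined K N h (leq_trans (leq_addr _ _) anm)).
by rewrite /cut_event (history_sub h anm).
Qed.

Definition no_cut_before (N m : nat) : set Omega :=
  [set w | forall a n K, (a + n <= m)%N -> ~~ good_event a n K N w].

Lemma no_cut_before_determined N m : determined m (no_cut_before N m).
Proof.
move=> w w' h Sw a n K anm; rewrite -(good_event_determined K N h anm); exact: Sw.
Qed.

Lemma past_event_cvg (a N : nat) (e : R) : 0 < e ->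
  exists K, (P [set w | ~~ past_event a K N w] <= e%:E)%E.
Proof.
move=> e0; pose A K := [set w | ~~ past_event a K N w].
have mA K : measurable (A K).
  apply: (@determined_measurable a) => w w' h; rewrite /A /=.
  by rewrite (past_event_determined K N h (leqnn a)).
have A0 : \bigcap_K A K = set0.
  apply/seteqP; split => // w Aw; pose X := Xs (fun i => xi i w).
  suff [B hB] : exists B : int, forall T, T < B ->
      all (fun i => ~~ low T (X i) (Lt i w) && ~~ low T (X i) (Rt i w)) (iota 0 a).
    (* This [K] puts [X a - K] below [B], hence below all labels of the past trees, and also at most
       [- N]. *)
    have := Aw (absz (X a) + absz B + N).+1 I; rewrite /A /= /past_event -/X hB; last by lia.
    by move=> /negP; apply => /=; lia.
  elim: (iota 0 a) => [|i s [B hB]]; first by exists 0.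
  have [B1 h1] := low_bounded (X i) (Lt i w); have [B2 h2] := low_bounded (X i) (Rt i w).
  exists (Order.min B (Order.min B1 B2)) => T; rewrite !lt_min => /and3P[TB TB1 TB2] /=.
  by rewrite h1// h2// hB.
have : (P \o A) K @[K --> \oo] --> P (\bigcap_K A K).
  apply: nonincreasing_cvg_mu => //.
  - by rewrite (le_lt_trans (probability_le1 _ _)) ?ltry.
  - exact: bigcapT_measurable.
  - move=> K K' KK'; apply/subsetPset => w; rewrite /A /=; apply: contra.
    rewrite /past_event => /andP[hall hN]; apply/andP; split; last by lia.
    apply: sub_all hall => i /andP[h1 h2]; apply/andP; split.
      by apply: contra h1; apply: low_mono; lia.
    by apply: contra h2; apply: low_mono; lia.
rewrite A0 measure0 => /fine_cvg /cvgrPdist_le /(_ _ e0) [K _ /(_ K (leqnn K))] /=.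
rewrite sub0r normrN ger0_norm ?fine_ge0// => h; exists K.
have fK : P (A K) \is a fin_num by exact: fin_num_measure.
by rewrite -/(A K) -(fineK fK) lee_fin.
Qed.

(* Whatever happened before time m, a cut vertex of low level is created later
   with conditional probability at least 1/64 - e. *)
Lemma no_cut_null N : P (\bigcap_m no_cut_before N m) = 0%E.
Proof.
pose E := no_cut_before N; set B := \bigcap_m E m.
have mE m : measurable (E m) by exact: (determined_measurable (@no_cut_before_determined N m)).
have mB : measurable B by exact: bigcapT_measurable.
pose p m := fine (P (E m)); pose b := fine (P B).
have pE m : P (E m) = (p m)%:E by rewrite fineK// fin_num_measure.
have bE : P B = b%:E by rewrite fineK// fin_num_measure.
have step_bound m : (0 < m)%N -> b <= (1 - 64^-1) * p m.
  (* The window starts at [a = m]. The level [K] clears the past up to probability [e], and only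
     then is [n] chosen, depending on [K]. *)
  move=> m0; apply/ler_addgt0Pr => e e0.
  have [K hK] := past_event_cvg m N e0.
  have [n hn] := cut_event_ge m K.
  have mC : measurable [set w | cut_event m n K w].
    by apply: (@determined_measurable (m + n)) => w w' h; rewrite /= /cut_event (history_sub h (leqnn _)).
  have mPast : measurable [set w | ~~ past_event m K N w].
    apply: (@determined_measurable m) => w w' h /=.
    by rewrite (past_event_determined K N h (leqnn m)).
  have := hn (history 0 m @` E m).
  rewrite -determined_preimage; last exact: no_cut_before_determined.
  have BE : (P B <= P (E m `\` [set w | cut_event m n K w]) + P [set w | ~~ past_event m K N w])%E.
    apply: le_trans (measureU2 _ _ _); [|exact: measurableD|by []].
    apply: le_measure; rewrite ?inE//; first by apply: measurableU => //; exact: measurableD.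
    move=> w Bw; have [past|past] := boolP (past_event m K N w); last by right.
    left; split; first exact: (Bw m).
    move=> /= cw; have := Bw (m + n)%N I m n K (leqnn _).
    by rewrite /good_event m0 past cw.
  have PE_lt : (P (E m) < +oo)%E by rewrite pE ltry.
  have DE : P (E m `\` [set w | cut_event m n K w]) =
      (P (E m) - P (E m `&` [set w | cut_event m n K w]))%E by exact: measureD.
  move: BE; rewrite DE.
  have mI : measurable (E m `&` [set w | cut_event m n K w]) by exact: measurableI.
  have xE : P (E m `&` [set w | cut_event m n K w]) =
      (fine (P (E m `&` [set w | cut_event m n K w])))%:E by rewrite fineK// fin_num_measure.
  have yE : P [set w | ~~ past_event m K N w] =
      (fine (P [set w | ~~ past_event m K N w]))%:E by rewrite fineK// fin_num_measure.
  move: hK; rewrite yE xE pE bE -EFinM -EFinB -EFinD !lee_fin; lra.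
have pcv : p m @[m --> \oo] --> b.
  have : (P \o E) m @[m --> \oo] --> P B.
    have PE0 : (P (E 0%N) < +oo)%E by rewrite pE ltry.
    apply: nonincreasing_cvg_mu => //.
    move=> i j ij; apply/subsetPset => w Ew a n K an; apply: Ew.
    exact: leq_trans an ij.
  by rewrite bE => /fine_cvg.
(* In the limit [p m] becomes [b] itself, which forces [b = 0]. *)
have : b <= (1 - 64^-1) * b.
  have hcv : (1 - 64^-1) * p m @[m --> \oo] --> (1 - 64^-1) * b.
    by apply: cvgM; [exact: cvg_cst|exact: pcv].
  rewrite -(cvg_lim _ hcv)//; apply: limr_ge; first by apply/cvg_ex; exists ((1 - 64^-1) * b).
  by exists 1%N => // m m0; exact: step_bound.
have b0 : 0 <= b by rewrite fine_ge0.
move=> h; rewrite bE; congr (_%:E); lra.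
Qed.

End Probability.

Lemma distinct_of_unbounded (V : Type) (l : V -> int) (Q : V -> Prop) :
  (forall N : nat, exists v, Q v /\ l v <= - Posz N) ->
  exists p : nat -> V, (forall i, Q (p i)) /\ (forall i j, i <> j -> p i <> p j).
Proof.
move=> /choice[f hf].
(* The next vertex is taken at or below level [-(|l (p i)| + 1)], hence strictly below the current
   label; strictly decreasing labels make the vertices distinct. *)
pose fix p i := if i is i'.+1 then f (absz (l (p i'))).+1 else f 0%N.
have lp i : l (p i.+1) < l (p i).
  by have := (hf (absz (l (p i))).+1).2; rewrite /=; lia.
have lt_l i j : (i < j)%N -> l (p j) < l (p i).
  elim: j => // j IH; rewrite ltnS leq_eqVlt => /predU1P[->//|/IH].
  exact: lt_trans.
exists p; split; first by case=> [|i]; exact: (hf _).1.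
move=> i j /eqP; rewrite neq_lt => /orP[] /lt_l h E; by rewrite E ltxx in h.
Qed.

Theorem theorem5 (d : measure_display) (Omega : measurableType d) (R : realType)
  (P : probability Omega R)
  (xi : nat -> Omega -> int) (Lt Rt : nat -> Omega -> ltree) (eta : Omega -> bool)
  (mxi : forall n z, measurable [set w | xi n w = z])
  (mL : forall n t, measurable [set w | Lt n w = t])
  (mR : forall n t, measurable [set w | Rt n w = t])
  (meta : forall b, measurable [set w | eta w = b])
  (lawxi : forall n z, P [set w | xi n w = z] = (if `|z| <= 1 then 3^-1 else 0)%:E)
  (lawL : forall n t, P [set w | Lt n w = t] = (rho0 R t)%:E)
  (lawR : forall n t, P [set w | Rt n w = t] = (rho0 R t)%:E)
  (laweta : forall b, P [set w | eta w = b] = (2^-1)%:E)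
  (indep : mutually_independent P xi Lt Rt eta) :
  {ae P, forall w,
    exists p : nat -> vert,
      (forall i, is_vertex (fun n => Lt n w) (fun n => Rt n w) (p i)) /\
      (forall i j, i <> j -> p i <> p j) /\
      (forall u : nat -> vert,
         proper_geodesic_ray (fun n => xi n w) (fun n => Lt n w) (fun n => Rt n w) u ->
         forall i, exists k, u k = p i)}.
Proof.
(* For each of the countably many depths [N], the event that no window succeeds with target level at
   most [- N] is null; off their union the labels of cut vertices are unbounded below. *)
pose Bad N := \bigcap_m no_cut_before xi Lt Rt N m.
have mE N m : measurable (no_cut_before xi Lt Rt N m).
  exact: (determined_measurable mxi mL mR (@no_cut_before_determined _ _ _ _ _ N m)).
have nBad : P.-negligible (\bigcup_N Bad N).
  apply: negligible_bigcup => N; apply/negligibleP; first exact: bigcapT_measurable.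
  exact: (no_cut_null mxi mL mR lawxi lawL lawR indep).
have nGood := good_ae mxi mL mR lawxi lawL lawR.
apply: negligibleS (negligibleU nBad nGood) => w /= hw; apply: contrapT => /not_orP[nb /contrapT good].
apply: hw.
have xi1 n : `|xi n w| <= 1 by have [] := good n.
have gL n : root_label (Lt n w) = 0 /\ good_labels (Lt n w) by have [] := good n.
have gR n : root_label (Rt n w) = 0 /\ good_labels (Rt n w) by have [] := good n.
pose Q v := is_vertex (Lt ^~ w) (Rt ^~ w) v /\
  forall u, proper_geodesic_ray (xi ^~ w) (Lt ^~ w) (Rt ^~ w) u -> exists k, u k = v.
have [|p [Qp dp]] := @distinct_of_unbounded vert (lab (xi ^~ w) (Lt ^~ w) (Rt ^~ w)) Q.
  move=> N; have : ~ Bad N w by move=> bw; apply: nb; exists N.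
  move=> /existsNP[m /not_implyP[_ /existsNP[a /existsNP[n /existsNP[K /not_implyP[_ /negP]]]]]].
  rewrite negbK => /and3P[a0 /andP[/allP past XN] /andP[]].
  rewrite /success; case E : (run _ _ _ _ _) => [m'|] // m'T later.
  have [|v [h1 h2 h3]] := cut_vertex xi1 gL gR a0 _ m'T E later.
    by move=> i ia; apply: past; rewrite mem_iota.
  by exists v; split=> //; apply: le_trans h2 XN.
by exists p; split; [|split => // u ru i]; [move=> i; exact: (Qp i).1|exact: (Qp i).2].
Qed.
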